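(* For every $\kappa \in (0,1/2)$ and every real number $\kappa' > 0$ there exists a constant $C > 0$, depending only on $\kappa$ and $\kappa'$, such that the following holds for every $\varepsilon > 0$. Let $\Phi : \mathbb{T}^2 \to \mathbb{T}^2$ be a diffeomorphism that mixes the set $A = \{(x_1,x_2) \in \mathbb{T}^2 : 0 \leqslant x_2 < 1/2\}$ up to scale $\varepsilon$ (with constant $\kappa$), and suppose that $$0 < \kappa' \leqslant \left| \det[\nabla_x \Phi(x)] \right| \quad \text{for all } x \in \mathbb{T}^2.$$ Then $$E(\Phi) \geqslant \frac{C}{\varepsilon^2}.$$
   Context: $\mathbb{T}^2 = \mathbb{R}^2/\mathbb{Z}^2$ is the flat two-dimensional torus with coordinates $x = (x_1,x_2) \in [0,1)\times[0,1)$, and $d\sigma$ and $\mathrm{Area}$ denote its standard area measure. $B_\varepsilon(x)$ is the ball in $\mathbb{T}^2$ of radius $\varepsilon$ centered at $x$, for the flat metric. For $\kappa \in (0,1/2)$, a diffeomorphism $\Phi : \mathbb{T}^2 \to \mathbb{T}^2$ mixes the set $A$ up to scale $\varepsilon$ (with constant $\kappa$) if for every $x \in \mathbb{T}^2$ $$\kappa\, \mathrm{Area}(B_\varepsilon(x)) \leqslant \mathrm{Area}(B_\varepsilon(x) \cap \Phi(A)) \leqslant (1-\kappa)\, \mathrm{Area}(B_\varepsilon(x)).$$ Write $\Phi = (\Phi^1,\Phi^2)$ in the coordinates of $\mathbb{T}^2$ (components of local lifts to $\mathbb{R}^2$; their partial derivatives $\Phi^i_{x_j}$ are well defined on $\mathbb{T}^2$),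 and let $\nabla_x\Phi$ be the $2\times 2$ Jacobian matrix. The energy density of $\Phi$ is $$e(\Phi) = \tfrac12\left[(\Phi^1_{x_1})^2 + (\Phi^1_{x_2})^2 + (\Phi^2_{x_1})^2 + (\Phi^2_{x_2})^2\right],$$ and the energy (cost) of $\Phi$ is $E(\Phi) = \int_{\mathbb{T}^2} e(\Phi)\, d\sigma$. *)

(* Defs.v *)
From HB Require Import structures.
From mathcomp Require Import all_boot all_order all_algebra.
From mathcomp Require Import all_classical all_reals all_analysis.

Set Implicit Arguments.
Unset Strict Implicit.
Unset Printing Implicit Defensive.

Import Order.TTheory GRing.Theory Num.Theory.
Import numFieldNormedType.Exports.

Local Open Scope classical_set_scope.
Local Open Scope ring_scope.

(* R^2 is R * R.  Its library norm is the max norm; this gives the usual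
   notions of differentiability and continuity, but metric balls must be taken
   for the Euclidean norm below. *)

Definition euclid_norm (R : realType) (v : R * R) : R :=
  Num.sqrt (v.1 ^+ 2 + v.2 ^+ 2).

Definition in_unit_square (R : realType) (p : R * R) : bool :=
  (0 <= p.1 < 1) && (0 <= p.2 < 1).

Definition unit_square (R : realType) : set (R * R) :=
  [set p | in_unit_square p].

(* A point of R^2/Z^2 is represented by its coordinates in [0,1) x [0,1). *)
Record torus (R : realType) : Type := Torus {
  tcoord : R * R;
  _ : in_unit_square tcoord }.

HB.instance Definition _ (R : realType) := [isSub for @tcoord R].

Definition fracpart (R : realType) (t : R) : R := t - (Num.floor t)%:~R.

Lemma fracpart_itv (R : realType) (t : R) : 0 <= fracpart t < 1.
Proof.
have /andP[h1 h2] := floor_itv t.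
by rewrite /fracpart subr_ge0 h1 ltrBlDl -[X in _ + X]/(1%:~R) -intrD.
Qed.

Lemma fracpart_unit_square (R : realType) (p : R * R) :
  in_unit_square (fracpart p.1, fracpart p.2).
Proof. by rewrite /in_unit_square !fracpart_itv. Qed.

(* The covering map R^2 -> R^2/Z^2. *)
Definition tproj (R : realType) (p : R * R) : torus R :=
  Torus (fracpart_unit_square p).

(* The flat metric: distance between the classes x + Z^2 and y + Z^2. *)
Definition flat_dist (R : realType) (x y : torus R) : R :=
  inf [set euclid_norm (tcoord x - tcoord y + (k.1%:~R, k.2%:~R))
      | k in [set: int * int]].

Definition flat_ball (R : realType) (x : torus R) (eps : R) : set (torus R) :=
  [set y | flat_dist x y < eps].

Notation lebesgue2 R := (@lebesgue_measure R \x @lebesgue_measure R)%E.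

Definition area (R : realType) (S : set (torus R)) : \bar R :=
  (lebesgue2 R) (@tcoord R @` S).

(* The representative of t modulo Z in [-1/2, 1/2). *)
Definition centered (R : realType) (t : R) : R := fracpart (t + 2^-1) - 2^-1.

(* local_lift Phi x is a lift of Phi, that is,
   tproj (local_lift Phi x q) = Phi (tproj q), and it maps tcoord x to
   tcoord (Phi x).  It may jump far from tcoord x, but when Phi is continuous
   it is continuous near tcoord x.  Any other lift that is continuous there
   differs from it near tcoord x by a constant of Z^2. *)
Definition local_lift (R : realType) (Phi : torus R -> torus R) (x : torus R)
    (q : R * R) : R * R :=
  let y := tcoord (Phi x) in
  let z := tcoord (Phi (tproj q)) in
  (y.1 + centered (z.1 - y.1), y.2 + centered (z.2 - y.2)).

Definition plane_coord (R : realType) (i : 'I_2) (p : R * R) : R :=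
  if i == 0 then p.1 else p.2.

Definition basis_vec (R : realType) (j : 'I_2) : R * R :=
  if j == 0 then (1, 0) else (0, 1).

(* partial Phi i j x is the partial derivative of Phi^i in x_j at x. *)
Definition partial (R : realType) (Phi : torus R -> torus R) (i j : 'I_2)
    (x : torus R) : R :=
  'D_(basis_vec R j) (fun q => plane_coord i (local_lift Phi x q)) (tcoord x).

Definition jacobian_mx (R : realType) (Phi : torus R -> torus R)
    (x : torus R) : 'M[R]_2 :=
  \matrix_(i, j) partial Phi i j x.

(* Functions on the torus are continuous for the quotient topology iff their
   composites with tproj are continuous on R^2. *)
Definition C1_map (R : realType) (Phi : torus R -> torus R) : Prop :=
  (forall x, differentiable (local_lift Phi x) (tcoord x)) /\
  (forall i j, continuous (fun p : R * R => partial Phi i j (tproj p))).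

Definition diffeomorphism (R : realType) (Phi : torus R -> torus R) : Prop :=
  exists Psi : torus R -> torus R,
    [/\ cancel Phi Psi, cancel Psi Phi, C1_map Phi & C1_map Psi].

Definition mixes (R : realType) (kappa eps : R) (Phi : torus R -> torus R)
    (A : set (torus R)) : Prop :=
  forall x : torus R,
    (kappa%:E * area (flat_ball x eps)
       <= area (flat_ball x eps `&` (Phi @` A)))%E /\
    (area (flat_ball x eps `&` (Phi @` A))
       <= (1 - kappa)%:E * area (flat_ball x eps))%E.

Definition energy_density (R : realType) (Phi : torus R -> torus R)
    (x : torus R) : R :=
  2^-1 * ((partial Phi 0 0 x) ^+ 2 + (partial Phi 0 1 x) ^+ 2
        + (partial Phi 1 0 x) ^+ 2 + (partial Phi 1 1 x) ^+ 2).

Definition energy (R : realType) (Phi : torus R -> torus R) : \bar R :=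
  (\int[lebesgue2 R]_(p in @unit_square R)
     (energy_density Phi (tproj p))%:E)%E.

Definition half_torus (R : realType) : set (torus R) :=
  [set x | 0 <= (tcoord x).2 < 2^-1].

(* Main.v *)
Require Import Defs.
From HB Require Import structures.
From mathcomp Require Import all_boot all_order all_algebra.
From mathcomp Require Import all_classical all_reals all_analysis.
From mathcomp Require Import measurable_realfun zify ring lra.

Set Implicit Arguments.
Unset Strict Implicit.
Unset Printing Implicit Defensive.

Import Order.TTheory GRing.Theory Num.Theory.
Import numFieldNormedType.Exports.

Local Open Scope classical_set_scope.
Local Open Scope ring_scope.

(** Let [Psi] be the inverse of [Phi], let [h x = sin (2 pi x_2)], which is
    nonnegative exactly on the half torus up to its boundary, and let
    [g = h o Psi].  Mixing forces [g] to change sign at scale [eps] everywhere: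
    on each square of side comparable to [eps] it is nonnegative, and also
    nonpositive, on a fixed proportion of the area.  A Poincare inequality
    without mean value then bounds [g] by its gradient ([poincare_mixing]):

      int |g|  <=  C eps / kappa * int (|d_1 Psi^2| + |d_2 Psi^2|).

    The two sides are transported to the source torus by the change of
    variables [y = Phi x].  On the right, the second row of the inverse
    Jacobian matrix is [(- d_1 Phi^2, d_1 Phi^1) / det], so that the weight
    [|det|] cancels exactly and one is left with
    [int (|d_1 Phi^2| + |d_1 Phi^1|)], at most [lam E(Phi) + 1 / lam] for each
    [lam > 0].  On the left, [|det| >= kappa'] gives
    [int |g| >= kappa' * int |h|], a positive constant.  Hence
    [c <= M eps (lam E(Phi) + 1 / lam)] for all [lam > 0]
    ([energy_tradeoff]), and [lam] proportional to [eps] gives the bound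
    ([optimize_scale]).  For [eps > 1/2] the pointwise inequality
    [e(Phi) >= |det| >= kappa'] suffices ([energy_ge_jac]).

    Only one inequality of the change of variables formula is needed, and only
    up to a constant ([integral_image_le]).  It is proved by bisection: if it
    failed on a square, it would fail on one of its four quarters, hence on
    squares shrinking to a point ([cousin_cell]); but near a point [Phi] is
    linear up to a small error, and the image of a small square is covered by
    sheared strips whose area is controlled by the determinant
    ([linear_image_cover]).  Pointwise differentiability is enough for this,
    and no global lift of [Phi] to the plane is used: the derivatives of [Phi]
    at each point are read on a local lift ([plane_lift]). *)

(** * Squares and bisection *)

(** An open set is a countable union of rational boxes. *)
Lemma open_measurable_prod (R : realType) (U : set (R * R)) :
  open U -> measurable U.
Proof.
move=> oU.
pose F (q : rat * rat * rat) : set (R * R) :=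
  if pselect (ball (ratr q.1.1 : R) (ratr q.2) `*` ball (ratr q.1.2 : R) (ratr q.2)
              `<=` U)
  then ball (ratr q.1.1 : R) (ratr q.2) `*` ball (ratr q.1.2 : R) (ratr q.2)
  else set0.
have -> : U = \bigcup_q F q.
  apply/seteqP; split=> [p Up|p [q _]]; last first.
    by rewrite /F; case: pselect => // sU /sU.
  have /nbhs_ballP[e /= e0 eU] : nbhs p U by exact: open_nbhs_nbhs.
  have [r /andP[r0 re]] : exists r : rat, (0 < ratr r :> R) && (ratr r < e / 2).
    have : (0 : R) < e / 2 by rewrite divr_gt0.
    by move=> /rat_in_itvoo[r]; rewrite in_itv /=; exists r.
  have app (x : R) : exists q : rat, ball (ratr q : R) (ratr r) x.
    have : x - ratr r < x + ratr r by lra.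
    move=> /rat_in_itvoo[q]; rewrite in_itv /= => /andP[h1 h2]; exists q.
    by rewrite /ball /= ltr_norml; lra.
  have [q1 h1] := app p.1; have [q2 h2] := app p.2.
  exists (q1, q2, r) => //; rewrite /F /=; case: pselect => //.
  case=> z [z1 z2]; apply: eU; split=> /=.
    move: h1 z1; rewrite /ball /= !ltr_norml; lra.
  move: h2 z2; rewrite /ball /= !ltr_norml; lra.
apply: countable_bigcupT_measurable.
  exact: countableP.
move=> q; rewrite /F; case: pselect => [sU|sU] /=; last exact: measurable0.
by apply: measurableX; apply: open_measurable; exact: ball_open.
Qed.

Lemma continuous_measurable_prod (R : realType) (f : R * R -> R) :
  continuous f -> measurable_fun setT f.
Proof.
move=> /continuousP cf; apply: (measurability _ (RGenOpens.measurableE R)).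
move=> _ [B [a [b ->]] <-]; rewrite setTI; apply: open_measurable_prod.
exact/cf/interval_open.
Qed.

Lemma measurable_EFin_continuous (R : realType) (f : R * R -> R) :
  continuous f -> measurable_fun setT (fun p => (f p)%:E).
Proof. by move=> cf; apply/measurable_EFinP; exact: continuous_measurable_prod. Qed.

(** Half-open squares, so that a square is the disjoint union of its four
    quarters. *)
Definition cell (R : realType) (a : R * R) (s : R) : set (R * R) :=
  `[a.1, a.1 + s[ `*` `[a.2, a.2 + s[.

Lemma measurable_cell (R : realType) (a : R * R) (s : R) :
  measurable (cell a s).
Proof. exact: measurableX. Qed.

Lemma cellE (R : realType) (a : R * R) (s : R) (p : R * R) :
  cell a s p <-> (a.1 <= p.1 < a.1 + s) /\ (a.2 <= p.2 < a.2 + s).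
Proof. by rewrite /cell /= !in_itv /=. Qed.

Lemma unit_squareE (R : realType) : @unit_square R = cell (0, 0) 1.
Proof.
apply/seteqP; split=> p; rewrite cellE /unit_square /in_unit_square /= !add0r.
  by move/andP.
by move=> [-> ->].
Qed.

Lemma lebesgue_measure_co (R : realType) (x s : R) : 0 <= s ->
  lebesgue_measure `[x, x + s[%classic = s%:E.
Proof.
move=> s0; rewrite lebesgue_measure_itv /= lte_fin ltrDl.
have [s1|s1] := ltP 0 s; first by rewrite -EFinD; congr (_%:E); ring.
by congr (_%:E); apply/eqP; rewrite eq_le s0 s1.
Qed.

Lemma measure_cell (R : realType) (a : R * R) (s : R) : 0 <= s ->
  lebesgue2 R (cell a s) = (s ^+ 2)%:E.
Proof.
move=> s0; rewrite product_measure1E //.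
rewrite [X in (X * _)%E](lebesgue_measure_co _ s0).
by rewrite [X in (_ * X)%E](lebesgue_measure_co _ s0) -EFinM expr2.
Qed.

Lemma measurable_unit_square (R : realType) : measurable (@unit_square R).
Proof. by rewrite unit_squareE; exact: measurable_cell. Qed.

Lemma measure_unit_square (R : realType) : lebesgue2 R (@unit_square R) = 1%E.
Proof. by rewrite unit_squareE measure_cell // expr1n. Qed.

(** With [T] the inverse of a map of the torus, the integrals are taken over images
    of squares; with [T] the identity, over the squares themselves. *)
Lemma integral_preimage_cell_split (R : realType) (D : set (R * R))
    (T : R * R -> R * R) (f : R * R -> \bar R) (a : R * R) (s : R) :
  measurable D -> measurable_fun setT T -> measurable_fun setT f ->
  (forall p, 0 <= f p)%E -> 0 < s ->
  let J A : \bar R := (\int[lebesgue2 R]_(p in D `&` T @^-1` A) f p)%E in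
  let a00 := a in let a10 := (a.1 + s / 2, a.2) in
  let a01 := (a.1, a.2 + s / 2) in let a11 := (a.1 + s / 2, a.2 + s / 2) in
  J (cell a s) =
    (J (cell a00 (s / 2)%R) + J (cell a10 (s / 2)%R)
     + (J (cell a01 (s / 2)%R) + J (cell a11 (s / 2)%R)))%E.
Proof.
move=> mD mT mf f0 s0 J a00 a10 a01 a11; rewrite /a00 /a10 /a01 /a11 {a00 a10 a01 a11}.
have JU A B : measurable A -> measurable B -> A `&` B = set0 ->
    J (A `|` B) = (J A + J B)%E.
  move=> mA mB AB; rewrite /J preimage_setU setIUr.
  have mTp X : measurable X -> measurable (D `&` T @^-1` X).
    by move=> mX; apply: measurableI => //; rewrite -[X in measurable X]setTI; exact: mT.
  rewrite ge0_integral_setU //; [exact: mTp|exact: mTp|exact: measurable_funTS|].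
  rewrite disj_set2E; apply/eqP/seteqP; split=> // x [[_ /= ?] [_ /= ?]].
  by have : (A `&` B) (T x) by []; rewrite AB.
have -> : cell a s =
    (cell a (s / 2) `|` cell (a.1 + s / 2, a.2) (s / 2)) `|`
    (cell (a.1, a.2 + s / 2) (s / 2) `|`
     cell (a.1 + s / 2, a.2 + s / 2) (s / 2)).
  apply/seteqP; split=> p; last first.
    by rewrite cellE => -[[]|[]]; rewrite cellE /= => -[/andP[? ?] /andP[? ?]];
      split; apply/andP; split; lra.
  rewrite cellE => -[/andP[h1 h2] /andP[h3 h4]].
  have [h5|h5] := ltP p.1 (a.1 + s / 2); have [h6|h6] := ltP p.2 (a.2 + s / 2).
  - by left; left; rewrite cellE /=; split; apply/andP; split; lra.
  - by right; left; rewrite cellE /=; split; apply/andP; split; lra.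
  - by left; right; rewrite cellE /=; split; apply/andP; split; lra.
  - by right; right; rewrite cellE /=; split; apply/andP; split; lra.
have mc := @measurable_cell R.
rewrite !JU //; try exact: measurableU.
- apply/seteqP; split=> // p [] /cellE [/andP[? ?] ?] /cellE [/= /andP[? ?] ?]; lra.
- apply/seteqP; split=> // p [] /cellE [/andP[? ?] ?] /cellE [/= /andP[? ?] ?]; lra.
- apply/seteqP; split=> // p [] [] /cellE [_ /andP[? ?]] [] /cellE [_ /= /andP[? ?]]; simpl in *; lra.
Qed.

(** The quarters of a square for which [good] fails cannot all be good, so there
    is a sequence of nested squares for which it fails; they shrink to a point,
    in contradiction with the second hypothesis. *)
Lemma cousin_cell (R : realType) (good : R * R -> R -> Prop) :
  (forall a s, 0 < s -> good a (s / 2) -> good (a.1 + s / 2, a.2) (s / 2) ->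
     good (a.1, a.2 + s / 2) (s / 2) ->
     good (a.1 + s / 2, a.2 + s / 2) (s / 2) -> good a s) ->
  (forall p : R * R, exists2 d : R, 0 < d & forall a s, 0 < s < d ->
     a.1 <= p.1 <= a.1 + s -> a.2 <= p.2 <= a.2 + s -> good a s) ->
  forall a s, 0 < s -> good a s.
Proof.
move=> step loc a0 s0 s0_gt0; apply: contrapT => bad0.
have next (x : (R * R) * R) : exists b : R * R, 0 < x.2 -> ~ good x.1 x.2 ->
    [/\ ~ good b (x.2 / 2), x.1.1 <= b.1 <= x.1.1 + x.2 / 2
      & x.1.2 <= b.2 <= x.1.2 + x.2 / 2].
  case: x => a s /=; have [s_gt0|] := ltP 0 s; last by move=> h; exists a => h'; lra.
  apply: contrapT => /forallNP nb.
  have H b : a.1 <= b.1 <= a.1 + s / 2 -> a.2 <= b.2 <= a.2 + s / 2 -> good b (s / 2).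
    move=> h1 h2; apply: contrapT => nbb; apply: (nb b) => _ _; split => //.
  by apply: (nb a) => _ []; apply: step => //; apply: H => /=; lra.
have [nx nxP] := choice next.
pose q n := iter n (fun x => (nx x, x.2 / 2)) (a0, s0).
have qs n : 0 < (q n).2 /\ ~ good (q n).1 (q n).2.
  elim: n => [//|n [p1 p2]] /=; split; first by rewrite divr_gt0.
  by have [] := nxP (q n) p1 p2.
have qS n : (q n.+1).2 = (q n).2 / 2 by [].
have q1 n := let: And3 _ h _ := nxP (q n) (qs n).1 (qs n).2 in h.
have q2 n := let: And3 _ _ h := nxP (q n) (qs n).1 (qs n).2 in h.
have q1' n : (q n).1.1 <= (q n.+1).1.1 <= (q n).1.1 + (q n).2 / 2 by exact: q1.
have q2' n : (q n).1.2 <= (q n.+1).1.2 <= (q n).1.2 + (q n).2 / 2 by exact: q2.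
have lim (u : nat -> R) : (forall n, u n <= u n.+1 <= u n + (q n).2 / 2) ->
    exists l, forall n, u n <= l <= u n + (q n).2.
  move=> hu.
  have mono n m : u n <= u (n + m)%N /\ u (n + m)%N + (q (n + m)%N).2 <= u n + (q n).2.
    elim: m => [|m [ih1 ih2]]; first by rewrite addn0.
    rewrite addnS qS; have /andP[h1 h2] := hu (n + m)%N.
    have h3 := (qs (n + m)%N).1; split; first exact: le_trans ih1 h1.
    by apply: le_trans ih2; lra.
  have ub n m : u m <= u n + (q n).2.
    have h1 := (mono n m); have h2 := mono m n.
    have h3 := (qs (n + m)%N).1; rewrite addnC in h2; lra.
  have hs : has_sup (range u).
    by split; [exists (u 0%N), 0%N|exists (u 0%N + (q 0%N).2) => _ [m _ <-]].
  exists (sup (range u)) => n; apply/andP; split.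
    by apply: ub_le_sup; [exact: hs.2|exists n].
  by apply: ge_sup; [exact: hs.1|move=> _ [m _ <-]].
have [l1 hl1] := lim _ q1'; have [l2 hl2] := lim _ q2'.
have [d d0 dP] := loc (l1, l2).
have qE n : (q n).2 = s0 / 2 ^+ n.
  elim: n => [|n ih]; first by rewrite expr0 divr1.
  by rewrite qS ih exprS; field; rewrite expf_neq0.
have [n hn] : exists n, (q n).2 < d.
  exists (Num.truncn (s0 / d)).+1.
  rewrite qE ltr_pdivrMr ?exprn_gt0 // mulrC -ltr_pdivrMr //.
  apply: (lt_trans (truncnS_gt _)).
  by rewrite -natrX ltr_nat ltn_expl.
by apply: (qs n).2; apply: dP; [rewrite (qs n).1|exact: hl1|exact: hl2].
Qed.

(** * Area of the linear image of a square *)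

Lemma lebesgue2_xsection (R : realType) (A : set (R * R)) :
  lebesgue2 R A = (\int[@lebesgue_measure R]_x lebesgue_measure (xsection A x))%E.
Proof. by []. Qed.

Lemma lebesgue2_ysection (R : realType) (A : set (R * R)) : measurable A ->
  lebesgue2 R A = (\int[@lebesgue_measure R]_y lebesgue_measure (ysection A y))%E.
Proof.
move=> mA; rewrite lebesgue2_xsection.
transitivity (\int[@lebesgue_measure R]_x
    fubini_F lebesgue_measure (EFin \o \1_A) x)%E.
  by rewrite indic_fubini_tonelli_FE.
rewrite (indic_fubini_tonelli (@lebesgue_measure R)) //.
by rewrite indic_fubini_tonelli_GE.
Qed.

Lemma lebesgue_measure_cc (R : realType) (e r : R) : 0 <= r ->
  lebesgue_measure `[e - r, e + r]%classic = (2 * r)%:E.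
Proof.
move=> r0; rewrite lebesgue_measure_itv /= lte_fin.
case: ltP => h; first by rewrite -EFinD; congr (_%:E); ring.
by congr (_%:E); lra.
Qed.

Lemma integral_le_supported (R : realType) (f : R -> \bar R) (e r b : R) :
  0 <= r -> 0 <= b -> measurable_fun setT f -> (forall x, 0 <= f x)%E ->
  (forall x, f x <= b%:E)%E -> (forall x, r < `|x - e| -> f x = 0%E) ->
  (\int[@lebesgue_measure R]_x f x <= (2 * r * b)%:E)%E.
Proof.
move=> r0 b0 mf f0 fb fz.
set I := `[e - r, e + r]%classic.
have -> : f = f \_ I.
  apply/funext => x; rewrite /patch; case: ifPn => // /negP; rewrite inE => xI.
  apply: fz; rewrite ltNge; apply/negP => h; apply: xI.
  by move: h; rewrite /I /= in_itv /= ler_norml; lra.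
rewrite -integral_mkcond.
apply: (@le_trans _ _ (\int[@lebesgue_measure R]_(x in I) b%:E)%E).
  apply: ge0_le_integral => //.
  - exact: measurable_itv.
  - exact: measurable_funTS.
rewrite integral_cst; last exact: measurable_itv.
by rewrite [X in (_ * X)%E](lebesgue_measure_cc e r0) -EFinM lee_fin mulrC.
Qed.

(** A sheared rectangle: its vertical sections are translates of one interval. *)
Definition strip (R : realType) (e : R * R) (m alpha beta : R) : set (R * R) :=
  [set y | `|y.1 - e.1| <= alpha /\ `|y.2 - e.2 - m * (y.1 - e.1)| <= beta].

Lemma measurable_strip (R : realType) (e : R * R) (m alpha beta : R) :
  measurable (strip e m alpha beta).
Proof.
pose f1 := fun y : R * R => y.1 - e.1.
pose f2 := fun y : R * R => y.2 - e.2 - m * (y.1 - e.1).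
have -> : strip e m alpha beta =
   f1 @^-1` `[- alpha, alpha] `&` f2 @^-1` `[- beta, beta].
  by apply/seteqP; split=> y; rewrite /strip /= !in_itv /= !ler_norml.
have m1 : measurable_fun setT f1.
  by apply: measurable_funB => //; exact: measurable_fst.
have m2 : measurable_fun setT f2.
  apply: measurable_funB; last exact: measurable_funM.
  by apply: measurable_funB => //; exact: measurable_snd.
apply: measurableI; first by rewrite -[X in measurable X]setTI; exact: m1.
by rewrite -[X in measurable X]setTI; exact: m2.
Qed.

Lemma measure_strip (R : realType) (e : R * R) (m alpha beta : R) :
  0 <= alpha -> 0 <= beta ->
  (lebesgue2 R (strip e m alpha beta) <= (4 * alpha * beta)%:E)%E.
Proof.
move=> a0 b0; rewrite lebesgue2_xsection.
have -> : 4 * alpha * beta = 2 * alpha * (2 * beta) by ring.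
have sub x : xsection (strip e m alpha beta) x `<=`
    `[(e.2 + m * (x - e.1)) - beta, (e.2 + m * (x - e.1)) + beta].
  move=> y /xsectionP [/= _]; rewrite in_itv /= ler_norml; lra.
have mS := measurable_strip e m alpha beta.
apply: (@integral_le_supported _ _ e.1) => //.
- by rewrite mulr_ge0.
- exact: measurable_fun_xsection.
- move=> x; rewrite -(lebesgue_measure_cc (e.2 + m * (x - e.1)) b0).
  by apply: le_measure => //; rewrite inE //; apply: measurable_xsection.
- move=> x h; rewrite (_ : xsection _ _ = set0) ?measure0 //.
  apply/seteqP; split=> // y /xsectionP [/=]; lra.
Qed.

Lemma measurable_swap_strip (R : realType) (e : R * R) (m alpha beta : R) :
  measurable (@unstable.swap R R @^-1` strip e m alpha beta).
Proof.
rewrite -[X in measurable X]setTI.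
by apply: (@measurable_swap _ _ R R) => //; exact: measurable_strip.
Qed.

Lemma measure_swap_strip (R : realType) (e : R * R) (m alpha beta : R) :
  0 <= alpha -> 0 <= beta ->
  (lebesgue2 R (@unstable.swap R R @^-1` strip e m alpha beta)
     <= (4 * alpha * beta)%:E)%E.
Proof.
move=> a0 b0; rewrite lebesgue2_ysection; last exact: measurable_swap_strip.
exact: measure_strip.
Qed.

(** After a shear along the row that contains an entry of maximal modulus [M],
    the image of the square of half side [s] fits in a rectangle with half sides
    [2 M s] and [|det| s / M]. *)
Lemma exists_shear (R : realType) (a b c d : R) : a * d - b * c != 0 ->
  exists2 M : R, 0 < M &
    (exists2 m : R, `|m| <= 1 & forall s v1 v2 : R, `|v1| <= s -> `|v2| <= s ->
       `|a * v1 + b * v2| <= 2 * M * s /\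
       `|c * v1 + d * v2 - m * (a * v1 + b * v2)|
          <= `|a * d - b * c| / M * s)
    \/
    (exists2 m : R, `|m| <= 1 & forall s v1 v2 : R, `|v1| <= s -> `|v2| <= s ->
       `|c * v1 + d * v2| <= 2 * M * s /\
       `|a * v1 + b * v2 - m * (c * v1 + d * v2)|
          <= `|a * d - b * c| / M * s).
Proof.
have core (x y z w : R) : x != 0 -> `|y| <= `|x| -> `|z| <= `|x| ->
    exists2 m : R, `|m| <= 1 & forall s v1 v2 : R, `|v1| <= s -> `|v2| <= s ->
       `|x * v1 + y * v2| <= 2 * `|x| * s /\
       `|z * v1 + w * v2 - m * (x * v1 + y * v2)|
          <= `|x * w - y * z| / `|x| * s.
  move=> x0 yx zx; have nx : 0 < `|x| by rewrite normr_gt0.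
  exists (z / x); first by rewrite normrM normfV ler_pdivrMr ?mul1r.
  move=> s v1 v2 h1 h2; split.
    apply: le_trans (ler_normD _ _) _; rewrite !normrM.
    have -> : 2 * `|x| * s = `|x| * s + `|x| * s by ring.
    by apply: lerD; apply: ler_pM.
  have -> : z * v1 + w * v2 - z / x * (x * v1 + y * v2) =
     (x * w - y * z) / x * v2 by field.
  by rewrite normrM normf_div ler_wpM2l // divr_ge0.
move=> det0.
have [/andP[h1 /andP[h2 h3]]|H1] := boolP [&& `|b| <= `|a|, `|c| <= `|a| & `|d| <= `|a|].
  have a0 : a != 0.
    apply: contra det0 => /eqP a0; move: h1 h2 h3; rewrite a0 normr0 !normr_le0.
    by move=> /eqP-> /eqP-> /eqP->; rewrite !mul0r subr0.
  by exists `|a|; [rewrite normr_gt0|left; apply: core].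
have [/andP[h1 /andP[h2 h3]]|H2] := boolP [&& `|a| <= `|b|, `|c| <= `|b| & `|d| <= `|b|].
  have b0 : b != 0.
    apply: contra det0 => /eqP a0; move: h1 h2 h3; rewrite a0 normr0 !normr_le0.
    by move=> /eqP-> /eqP-> /eqP->; rewrite !mul0r subr0.
  exists `|b|; [by rewrite normr_gt0|left].
  have [m m1 mP] := core b a d c b0 h1 h3; exists m => // s v1 v2 s1 s2.
  have := mP s v2 v1 s2 s1.
  by rewrite [b * v2 + _]addrC [d * v2 + _]addrC [`|b * c - _|]distrC.
have [/andP[h1 /andP[h2 h3]]|H3] := boolP [&& `|a| <= `|c|, `|b| <= `|c| & `|d| <= `|c|].
  have c0 : c != 0.
    apply: contra det0 => /eqP a0; move: h1 h2 h3; rewrite a0 normr0 !normr_le0.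
    by move=> /eqP-> /eqP-> /eqP->; rewrite !mul0r subr0.
  exists `|c|; [by rewrite normr_gt0|right].
  have [m m1 mP] := core c d a b c0 h3 h1; exists m => // s v1 v2 s1 s2.
  have := mP s v1 v2 s1 s2.
  by rewrite [`|c * b - _|]distrC [c * b]mulrC [d * a]mulrC.
have h : [&& `|a| <= `|d|, `|b| <= `|d| & `|c| <= `|d|].
  move: H1 H2 H3; rewrite -!(rwP negP); lra.
have /and3P[h1 h2 h3] := h.
have d0 : d != 0.
  apply: contra det0 => /eqP a0; move: h1 h2 h3; rewrite a0 normr0 !normr_le0.
  by move=> /eqP-> /eqP-> /eqP->; rewrite !mul0r subr0.
exists `|d|; [by rewrite normr_gt0|right].
have [m m1 mP] := core d c b a d0 h3 h2; exists m => // s v1 v2 s1 s2.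
have := mP s v2 v1 s2 s1.
by rewrite [d * v2 + _]addrC [b * v2 + _]addrC [d * a]mulrC [c * b]mulrC.
Qed.

Definition unit_shifts (R : realType) : seq (R * R) :=
  [:: (-1, -1); (-1, 0); (-1, 1); (0, -1); (0, 0); (0, 1); (1, -1); (1, 0); (1, 1)].

(** The image of a square of half side [s] under a map that is linear up to an
    error [eta * s] lies in a sheared strip; on the torus the nine translates
    account for all the representatives in the unit square.  The area is not
    computed exactly; its linear dependence on the determinant is what matters. *)
Lemma linear_image_cover (R : realType) (a b c d e : R) :
  a * d - b * c != 0 -> 0 < e ->
  exists2 eta : R, 0 < eta & forall (s : R) (y0 : R * R), 0 < s ->
    exists P : set (R * R), [/\ measurable P,
      (lebesgue2 R P <= (36 * (2 * `|(a * d - b * c)%R| + e) * s ^+ 2)%:E)%E &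
      forall v1 v2 r1 r2 y k, `|v1| <= s -> `|v2| <= s ->
        `|r1| <= eta * s -> `|r2| <= eta * s -> k \in unit_shifts R ->
        y = (y0.1 + a * v1 + b * v2 + r1 + k.1,
             y0.2 + c * v1 + d * v2 + r2 + k.2) -> P y].
Proof.
move=> det0 e0; have [M M0 H] := exists_shear det0.
set D := `|a * d - b * c| in H *.
have D0 : 0 <= D by exact: normr_ge0.
pose K := 4 * M + D / M + 2.
have DM0 : 0 <= D / M by rewrite divr_ge0 // ltW.
have K0 : 0 < K by rewrite /K; lra.
pose eta := Num.min 1 (e / K).
have eta0 : 0 < eta by rewrite /eta lt_min ltr01 divr_gt0.
have eta1 : eta <= 1 by rewrite /eta ge_min lexx.
have etaK : eta * K <= e.
  by rewrite -ler_pdivlMr // /eta ge_min lexx orbT.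
exists eta => // s y0 s0.
pose alpha := (2 * M + eta) * s; pose beta := (D / M + 2 * eta) * s.
have al0 : 0 <= alpha by rewrite /alpha mulr_ge0 ?addr_ge0 ?mulr_ge0 ?ltW.
have be0 : 0 <= beta.
  by rewrite /beta mulr_ge0 ?(ltW s0) // addr_ge0 // mulr_ge0 // ltW.
have ab : 4 * alpha * beta * 9 <= 36 * (2 * D + e) * s ^+ 2.
  have -> : 4 * alpha * beta * 9 =
      36 * ((2 * M + eta) * (D / M + 2 * eta)) * s ^+ 2.
    by rewrite /alpha /beta; ring.
  rewrite ler_wpM2r ?sqr_ge0 // ler_wpM2l //.
  have -> : (2 * M + eta) * (D / M + 2 * eta) =
     2 * D + eta * (4 * M + D / M + 2 * eta) by field; rewrite gt_eqF.
  rewrite lerD2l; apply: le_trans etaK.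
  by apply: ler_wpM2l; [exact: ltW|rewrite /K lerD2l; lra].
have cover (Q : R * R -> set (R * R)) : (forall k, measurable (Q k)) ->
    (forall k, lebesgue2 R (Q k) <= (4 * alpha * beta)%:E)%E ->
    exists P : set (R * R), [/\ measurable P,
      (lebesgue2 R P <= (36 * (2 * D + e) * s ^+ 2)%:E)%E &
      forall k y, k \in unit_shifts R -> Q k y -> P y].
  move=> mQ hQ; exists (\big[setU/set0]_(k <- unit_shifts R) Q k); split.
  - exact: bigsetU_measurable.
  - apply: (@le_trans _ _ (4 * alpha * beta * 9)%:E); last by rewrite lee_fin.
    apply: (@le_trans _ _ (\sum_(k <- unit_shifts R) (4 * alpha * beta)%:E)%E).
      elim: (unit_shifts R) => [|k l ih]; first by rewrite !big_nil measure0.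
      rewrite !big_cons; apply: le_trans; last exact: leeD (hQ k) ih.
      by apply: measureU2; [exact: mQ|apply: bigsetU_measurable => *; exact: mQ].
    by rewrite /unit_shifts !big_cons big_nil -!EFinD lee_fin; lra.
  - move=> k y kl Qy; rewrite -bigcup_seq; by exists k.
have small m r1 r2 : `|m| <= 1 -> `|r1| <= eta * s -> `|r2| <= eta * s ->
    `|r2 - m * r1| <= 2 * eta * s.
  move=> m1 h1 h2; apply: le_trans (ler_normB _ _) _; rewrite normrM.
  have : `|m| * `|r1| <= 1 * (eta * s) by apply: ler_pM.
  lra.
case: H => -[m m1 mP].
- have [P [mP' lP PP]] := cover
    (fun k => strip (y0.1 + k.1, y0.2 + k.2) m alpha beta)
    (fun k => measurable_strip _ _ _ _) (fun k => measure_strip _ _ al0 be0).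
  exists P; split=> // v1 v2 r1 r2 y k hv1 hv2 hr1 hr2 kl ->.
  apply: (PP k) => //; rewrite /strip /=.
  have [h1 h2] := mP s v1 v2 hv1 hv2; have h3 := small m r1 r2 m1 hr1 hr2.
  split.
    have -> : y0.1 + a * v1 + b * v2 + r1 + k.1 - (y0.1 + k.1) =
      (a * v1 + b * v2) + r1 by ring.
    by apply: le_trans (ler_normD _ _) _; rewrite /alpha mulrDl lerD.
  have -> : y0.2 + c * v1 + d * v2 + r2 + k.2 - (y0.2 + k.2) -
     m * (y0.1 + a * v1 + b * v2 + r1 + k.1 - (y0.1 + k.1)) =
     (c * v1 + d * v2 - m * (a * v1 + b * v2)) + (r2 - m * r1) by ring.
  by apply: le_trans (ler_normD _ _) _; rewrite /beta mulrDl lerD.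
- have [P [mP' lP PP]] := cover
    (fun k => @unstable.swap R R @^-1` strip (y0.2 + k.2, y0.1 + k.1) m alpha beta)
    (fun k => measurable_swap_strip _ _ _ _)
    (fun k => measure_swap_strip _ _ al0 be0).
  exists P; split=> // v1 v2 r1 r2 y k hv1 hv2 hr1 hr2 kl ->.
  apply: (PP k) => //; rewrite /strip /=.
  have [h1 h2] := mP s v1 v2 hv1 hv2; have h3 := small m r2 r1 m1 hr2 hr1.
  split.
    have -> : y0.2 + c * v1 + d * v2 + r2 + k.2 - (y0.2 + k.2) =
      (c * v1 + d * v2) + r2 by ring.
    by apply: le_trans (ler_normD _ _) _; rewrite /alpha mulrDl lerD.
  have -> : y0.1 + a * v1 + b * v2 + r1 + k.1 - (y0.1 + k.1) -
     m * (y0.2 + c * v1 + d * v2 + r2 + k.2 - (y0.2 + k.2)) =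
     (a * v1 + b * v2 - m * (c * v1 + d * v2)) + (r1 - m * r2) by ring.
  by apply: le_trans (ler_normD _ _) _; rewrite /beta mulrDl lerD.
Qed.

(** * First-order expansions in the plane *)

Section expansion.
Variable R : realType.
Implicit Types (f g : R * R -> R) (p : R * R).

(** Differentiability at [p] with gradient [(a, b)].  This form applies to
    increments of [f], which do not change when an integer constant is added. *)
Definition expands f p (a b : R) : Prop :=
  forall e : R, 0 < e -> exists2 d : R, 0 < d & forall h1 h2 : R,
    `|h1| <= d -> `|h2| <= d ->
    `|f (p.1 + h1, p.2 + h2) - f p - (a * h1 + b * h2)| <= e * (`|h1| + `|h2|).

Lemma differentiable_expands f p : differentiable f p ->
  expands f p ('D_(1, 0) f p) ('D_(0, 1) f p).
Proof.
move=> df e e0.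
have /eqaddoP/(_ e e0) := diff_locally df.
move=> /nbhs_ballP[d /= d0 dP].
exists (d / 2); first by rewrite divr_gt0.
move=> h1 h2 l1 l2.
have /dP /= : ball (0 : R * R) d (h1, h2).
  by split; rewrite /ball /= sub0r normrN; apply: (le_lt_trans _ (_ : d / 2 < d)) => //; lra.
rewrite !fctE /=.
have -> : ((h1, h2) + p : R * R) = (p.1 + h1, p.2 + h2).
  by apply: injective_projections => /=; rewrite addrC.
have -> : 'd f p (h1, h2) = 'D_(1, 0) f p * h1 + 'D_(0, 1) f p * h2.
  rewrite !deriveE //.
  have -> : (h1, h2) = h1 *: (1, 0) + h2 *: (0, 1) :> R * R.
    by apply: injective_projections; rewrite /= /GRing.scale /= !(mulr1, mulr0, addr0, add0r).
  by rewrite linearD !linearZ /= mulrC [h2 *: _]mulrC.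
move=> h; rewrite -addrA -opprD; apply: le_trans h _; rewrite ler_wpM2l ?(ltW e0) //.
by rewrite prod_normE /= ge_max; apply/andP; split; [rewrite lerDl|rewrite lerDr].
Qed.

Lemma expands_small f p a b (e : R) : expands f p a b -> 0 < e ->
  exists2 d : R, 0 < d & forall h1 h2 : R, `|h1| <= d -> `|h2| <= d ->
    `|f (p.1 + h1, p.2 + h2) - f p| <= e.
Proof.
move=> fab e0; have [d d0 dP] := fab 1 ltr01.
pose K := `|a| + `|b| + 2.
have K0 : 0 < K by rewrite /K; have := normr_ge0 a; have := normr_ge0 b; lra.
exists (Num.min d (e / K)); first by rewrite lt_min d0 divr_gt0.
move=> h1 h2; rewrite !le_min => /andP[h1d h1e] /andP[h2d h2e].
have := dP h1 h2 h1d h2d; rewrite mul1r => h3.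
have -> : f (p.1 + h1, p.2 + h2) - f p =
  (f (p.1 + h1, p.2 + h2) - f p - (a * h1 + b * h2)) + a * h1 + b * h2 by ring.
have n1 : `|a * h1| <= `|a| * (e / K) by rewrite normrM ler_wpM2l.
have n2 : `|b * h2| <= `|b| * (e / K) by rewrite normrM ler_wpM2l.
apply: le_trans (ler_normD _ _) _.
have h4 := ler_normD (f (p.1 + h1, p.2 + h2) - f p - (a * h1 + b * h2)) (a * h1).
have : K * (e / K) = e by rewrite mulrCA mulfV ?mulr1 // gt_eqF.
rewrite /K !mulrDl; lra.
Qed.

Lemma expands_continuous f p a b : expands f p a b -> {for p, continuous f}.
Proof.
move=> fab; apply/cvgrPdist_le => e e0.
have [d d0 dP] := expands_small fab e0.
apply: filterS (nbhsx_ballx p d d0) => -[q1 q2] [/= h1 h2].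
have := dP (q1 - p.1) (q2 - p.2).
have -> : (p.1 + (q1 - p.1), p.2 + (q2 - p.2)) = (q1, q2) by rewrite !(addrC p.1) !(addrC p.2) !subrK.
by move=> H; rewrite distrC; apply: H; rewrite distrC ltW.
Qed.

Lemma expands_unique f p a b a' b' :
  expands f p a b -> expands f p a' b' -> a = a' /\ b = b'.
Proof.
move=> f1 f2.
have key e : 0 < e -> `|a - a'| <= e /\ `|b - b'| <= e.
  move=> e0; have e2 : 0 < e / 2 by rewrite divr_gt0.
  have [d1 d10 P1] := f1 _ e2; have [d2 d20 P2] := f2 _ e2.
  pose d := Num.min d1 d2; have d0 : 0 < d by rewrite /d lt_min d10.
  have dd1 : d <= d1 by rewrite /d ge_min lexx.
  have dd2 : d <= d2 by rewrite /d ge_min lexx orbT.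
  have nd : `|d| = d by rewrite gtr0_norm.
  have n0 : `|0 : R| = 0 by rewrite normr0.
  split.
    have := P1 d 0; rewrite nd n0 => /(_ dd1 (ltW d10)) h1.
    have := P2 d 0; rewrite nd n0 => /(_ dd2 (ltW d20)) h2.
    rewrite -(ler_pM2r d0) -{1}nd -normrM.
    set X := f _ - f p in h1 h2.
    have -> : (a - a') * d = (X - (a' * d + b' * 0)) - (X - (a * d + b * 0)) by ring.
    apply: le_trans (ler_normB _ _) _; lra.
  have := P1 0 d; rewrite nd n0 => /(_ (ltW d10) dd1) h1.
  have := P2 0 d; rewrite nd n0 => /(_ (ltW d20) dd2) h2.
  rewrite -(ler_pM2r d0) -{1}nd -normrM.
  set X := f _ - f p in h1 h2.
  have -> : (b - b') * d = (X - (a' * 0 + b' * d)) - (X - (a * 0 + b * d)) by ring.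
  apply: le_trans (ler_normB _ _) _; lra.
have z (x : R) : (forall e, 0 < e -> `|x| <= e) -> x = 0.
  move=> h; apply/eqP/contraT; rewrite -normr_gt0 => x0.
  have := h (`|x| / 2); rewrite divr_gt0 // => /(_ isT); lra.
by split; apply/eqP; rewrite -subr_eq0; apply/eqP/z => e /key[].
Qed.

Lemma expands_comp g f1 f2 p a b c d u v :
  expands f1 p a b -> expands f2 p c d -> expands g (f1 p, f2 p) u v ->
  expands (fun q => g (f1 q, f2 q)) p (u * a + v * c) (u * b + v * d).
Proof.
move=> F1 F2 G e e0.
pose K := `|a| + `|b| + `|c| + `|d| + 2; pose L := `|u| + `|v| + 1.
have K0 : 0 < K.
  rewrite /K; move: (normr_ge0 a) (normr_ge0 b) (normr_ge0 c) (normr_ge0 d); lra.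
have L0 : 0 < L by rewrite /L; move: (normr_ge0 u) (normr_ge0 v); lra.
pose eg := e / (2 * K); pose ef := Num.min 1 (e / (2 * L)).
have eg0 : 0 < eg by rewrite divr_gt0 // mulr_gt0.
have ef0 : 0 < ef by rewrite lt_min ltr01 divr_gt0 // mulr_gt0.
have ef1 : ef <= 1 by rewrite /ef ge_min lexx.
have efL : ef * L <= e / 2.
  have : ef <= e / (2 * L) by rewrite /ef ge_min lexx orbT.
  rewrite -(ler_pM2r L0) => h; apply: le_trans h _.
  by rewrite le_eqVlt; apply/orP; left; apply/eqP; field; rewrite gt_eqF.
have egK : eg * K = e / 2 by rewrite /eg; field; rewrite gt_eqF.
have [dg dg0 Pg] := G _ eg0.
have [d1 d10 P1] := F1 _ ef0; have [d2 d20 P2] := F2 _ ef0.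
have [d3 d30 P3] := expands_small F1 dg0; have [d4 d40 P4] := expands_small F2 dg0.
exists (Num.min (Num.min d1 d2) (Num.min d3 d4)); first by rewrite !lt_min d10 d20 d30.
move=> h1 h2; rewrite !le_min => /andP[/andP[a1 a2] /andP[a3 a4]].
move=> /andP[/andP[b1 b2] /andP[b3 b4]].
have := P1 _ _ a1 b1; have := P2 _ _ a2 b2; have := P3 _ _ a3 b3; have := P4 _ _ a4 b4.
set q := (p.1 + h1, p.2 + h2).
set X := f1 q - f1 p; set Y := f2 q - f2 p => s2 s1 r2 r1.
have := Pg X Y s1 s2 => /=; rewrite /X /Y !subrKC -/X -/Y => hg.
set Z := g (f1 q, f2 q) - _ in hg *.
pose r := X - (a * h1 + b * h2); pose t := Y - (c * h1 + d * h2).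
have -> : Z - ((u * a + v * c) * h1 + (u * b + v * d) * h2) =
  (Z - (u * X + v * Y)) + (u * r + v * t) by rewrite /r /t; ring.
pose N := `|h1| + `|h2|; rewrite -/N.
have N0 : 0 <= N by rewrite addr_ge0.
have n1 : `|h1| <= N by rewrite lerDl.
have n2 : `|h2| <= N by rewrite lerDr.
have bound (x y z w : R) : `|x - (y * h1 + z * h2)| <= ef * N ->
    `|x| <= (`|y| + `|z| + 1) * N.
  move=> hx; have -> : x = x - (y * h1 + z * h2) + (y * h1 + z * h2) by ring.
  apply: le_trans (ler_normD _ _) _.
  have h3 := ler_normD (y * h1) (z * h2); rewrite !normrM in h3.
  have h4 : `|y| * `|h1| <= `|y| * N by rewrite ler_wpM2l.
  have h5 : `|z| * `|h2| <= `|z| * N by rewrite ler_wpM2l.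
  have h6 : ef * N <= 1 * N by rewrite ler_wpM2r.
  rewrite !mulrDl; lra.
have bX := bound X a b 0 r1; have bY := bound Y c d 0 r2.
have bZ : `|Z - (u * X + v * Y)| <= e / 2 * N.
  apply: le_trans hg _; rewrite -egK -mulrA ler_pM2l // /K.
  move: bX bY; rewrite !mulrDl; lra.
have brt : `|u * r + v * t| <= e / 2 * N.
  apply: le_trans (ler_normD _ _) _; rewrite !normrM.
  have h4 : `|u| * `|r| <= `|u| * (ef * N) by rewrite ler_wpM2l.
  have h5 : `|v| * `|t| <= `|v| * (ef * N) by rewrite ler_wpM2l.
  have h6 : ef * L * N <= e / 2 * N by rewrite ler_wpM2r.
  have h7 : 0 <= ef * N by rewrite mulr_ge0 // ltW.
  have h8 : ef * L * N = `|u| * (ef * N) + `|v| * (ef * N) + ef * N by rewrite /L; ring.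
  lra.
apply: le_trans (ler_normD _ _) _.
have : e * N = e / 2 * N + e / 2 * N by field.
lra.
Qed.

(** The gradient depends only on the increments of the function near [p]. *)
Lemma expands_eq_near f g p a b (d : R) : expands f p a b -> 0 < d ->
  (forall h1 h2, `|h1| <= d -> `|h2| <= d ->
    g (p.1 + h1, p.2 + h2) - g p = f (p.1 + h1, p.2 + h2) - f p) ->
  expands g p a b.
Proof.
move=> fab d0 fg e e0; have [d' d'0 P] := fab e e0.
exists (Num.min d d'); first by rewrite lt_min d0.
by move=> h1 h2; rewrite !le_min => /andP[? ?] /andP[? ?]; rewrite fg //; apply: P.
Qed.

Lemma expands_fst p : expands (fun q => q.1) p 1 0.
Proof.
move=> e e0; exists 1 => // h1 h2 _ _ /=.
have -> : p.1 + h1 - p.1 - (1 * h1 + 0 * h2) = 0 by ring.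
by rewrite normr0 mulr_ge0 ?addr_ge0 ?(ltW e0).
Qed.

Lemma expands_snd p : expands (fun q => q.2) p 0 1.
Proof.
move=> e e0; exists 1 => // h1 h2 _ _ /=.
have -> : p.2 + h2 - p.2 - (0 * h1 + 1 * h2) = 0 by ring.
by rewrite normr0 mulr_ge0 ?addr_ge0 ?(ltW e0).
Qed.

Lemma is_derive_of_expansion (f : R -> R) (x a : R) :
  (forall e : R, 0 < e -> exists2 d : R, 0 < d & forall h : R, `|h| <= d ->
     `|f (x + h) - f x - a * h| <= e * `|h|) ->
  is_derive x 1 f a.
Proof.
move=> H.
suff cv : (fun h => h^-1 *: (f (h *: 1 + x) - f x)) @ 0^' --> a.
  by apply: DeriveDef; [apply/cvg_ex; exists a|apply/cvg_lim].
apply/cvgrPdist_le => e e0; have [d d0 P] := H e e0.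
exists d => //= h; rewrite /= sub0r normrN => hd h0.
rewrite /GRing.scale /= mulr1 [h + x]addrC.
have -> : a - h^-1 * (f (x + h) - f x) = - (h^-1 * (f (x + h) - f x - a * h)).
  by field.
rewrite normrN normrM normfV ler_pdivrMl ?normr_gt0 // [`|h| * e]mulrC.
exact: P h (ltW hd).
Qed.

Lemma expands_slice1 f p a b : expands f p a b ->
  is_derive p.1 1 (fun t => f (t, p.2)) a.
Proof.
move=> fab; apply: is_derive_of_expansion => e e0; have [d d0 P] := fab e e0.
exists d => // h hd; have := P h 0 hd; rewrite normr0 => /(_ (ltW d0)).
by rewrite mulr0 !addr0 -surjective_pairing.
Qed.

Lemma expands_slice2 f p a b : expands f p a b ->
  is_derive p.2 1 (fun t => f (p.1, t)) b.
Proof.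
move=> fab; apply: is_derive_of_expansion => e e0; have [d d0 P] := fab e e0.
exists d => // h hd; have := P 0 h; rewrite normr0 => /(_ (ltW d0) hd).
by rewrite mulr0 !(addr0, add0r) -surjective_pairing.
Qed.

End expansion.

(** * Local lifts of maps of the torus *)

Section torus.
Variable R : realType.
Implicit Types (p q : R * R) (x y : torus R) (t : R).

Lemma fracpartDz t (k : int) : fracpart (t + k%:~R) = fracpart t.
Proof. by rewrite /fracpart floorDrz ?intr_int // intrKfloor intrD; ring. Qed.

Lemma fracpart_id t : 0 <= t < 1 -> fracpart t = t.
Proof. by move=> h; rewrite /fracpart (floor_def (m := 0)) ?subr0. Qed.

Lemma fracpart_shift t : exists k : int, fracpart t = t + k%:~R.
Proof. by exists (- Num.floor t); rewrite intrN. Qed.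

Lemma fracpart_eqP t u : fracpart t = fracpart u -> exists k : int, u = t + k%:~R.
Proof.
move=> h; exists (Num.floor u - Num.floor t); move: h; rewrite /fracpart intrB; lra.
Qed.

Lemma centered_shift t : exists k : int, centered t = t + k%:~R.
Proof.
by have [k h] := fracpart_shift (t + 2^-1); exists k; rewrite /centered h; ring.
Qed.

Lemma centered_id t : `|t| < 2^-1 -> centered t = t.
Proof. by rewrite ltr_norml => h; rewrite /centered fracpart_id; lra. Qed.

Lemma tproj_shift p (k : int * int) :
  tproj (p.1 + k.1%:~R, p.2 + k.2%:~R) = tproj p.
Proof. by apply: val_inj; rewrite /= !fracpartDz. Qed.

Lemma tproj_eqP p q : tproj p = tproj q ->
  exists k : int * int, q = (p.1 + k.1%:~R, p.2 + k.2%:~R).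
Proof.
move=> /(congr1 (@tcoord R)) /= [/fracpart_eqP[k1 h1] /fracpart_eqP[k2 h2]].
by exists (k1, k2); rewrite -h1 -h2 -surjective_pairing.
Qed.

Lemma tcoord_itv x : (0 <= (tcoord x).1 < 1) /\ (0 <= (tcoord x).2 < 1).
Proof. by case: x => p /= /andP[]. Qed.

Lemma tcoordK x : tproj (tcoord x) = x.
Proof.
have [h1 h2] := tcoord_itv x.
by apply: val_inj; rewrite /= !fracpart_id // -surjective_pairing.
Qed.

Lemma tprojK p : @unit_square R p -> tcoord (tproj p) = p.
Proof.
rewrite /unit_square /= => /andP[h1 h2].
by rewrite !fracpart_id // -surjective_pairing.
Qed.

(** [local_lift] is based at a point of the unit square; this lift is based at an
    arbitrary [p], and is continuous there when [Phi] is continuous. *)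
Definition plane_lift (Phi : torus R -> torus R) p q : R * R :=
  local_lift Phi (tproj p) (q - p + tcoord (tproj p)).

Lemma tproj_tcoord_shift p q : tproj (q - p + tcoord (tproj p)) = tproj q.
Proof.
have [k hk] : exists k : int * int, tcoord (tproj p) = (p.1 + k.1%:~R, p.2 + k.2%:~R).
  by apply: tproj_eqP; rewrite tcoordK.
rewrite hk -(tproj_shift q k); congr tproj.
by apply: injective_projections => /=; ring.
Qed.

Lemma tproj_lift Phi p q : tproj (plane_lift Phi p q) = Phi (tproj q).
Proof.
rewrite /plane_lift /local_lift tproj_tcoord_shift.
set y := tcoord (Phi (tproj p)); set z := Phi (tproj q).
have [k1 ->] := centered_shift ((tcoord z).1 - y.1).
have [k2 ->] := centered_shift ((tcoord z).2 - y.2).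
rewrite -[RHS]tcoordK -(tproj_shift (tcoord z) (k1, k2)) /=.
by congr (tproj (_, _)); ring.
Qed.

Lemma lift_base Phi p : plane_lift Phi p p = tcoord (Phi (tproj p)).
Proof.
rewrite /plane_lift subrr add0r /local_lift tcoordK !subrr !centered_id ?normr0 ?invr_gt0 //.
by rewrite !addr0 -surjective_pairing.
Qed.

Lemma expands_lift Phi p : C1_map Phi ->
  expands (fun q => (plane_lift Phi p q).1) p
    (partial Phi 0 0 (tproj p)) (partial Phi 0 1 (tproj p)) /\
  expands (fun q => (plane_lift Phi p q).2) p
    (partial Phi 1 0 (tproj p)) (partial Phi 1 1 (tproj p)).
Proof.
move=> [dPhi _]; set x := tproj p.
have h1 : differentiable (fun q => plane_coord 0 (local_lift Phi x q)) (tcoord x).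
  apply: (@differentiable_comp _ _ _ _ (local_lift Phi x) fst); first exact: dPhi.
  by apply: linear_differentiable; move=> z; exact: cvg_fst.
have h2 : differentiable (fun q => plane_coord 1 (local_lift Phi x q)) (tcoord x).
  apply: (@differentiable_comp _ _ _ _ (local_lift Phi x) snd); first exact: dPhi.
  by apply: linear_differentiable; move=> z; exact: cvg_snd.
have shift f a b : expands (fun q => f (local_lift Phi x q)) (tcoord x) a b ->
    expands (fun q => f (plane_lift Phi p q)) p a b.
  move=> H e e0; have [d d0 P] := H e e0; exists d => // k1 k2 hk1 hk2.
  have := P k1 k2 hk1 hk2; rewrite /plane_lift subrr add0r -/x.
  congr (`|f (local_lift _ _ _) - _ - _| <= _).
  by apply: injective_projections => /=; ring.
split; apply: shift.
  exact: differentiable_expands h1.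
exact: differentiable_expands h2.
Qed.
End torus.

Section torus_maps.
Variable R : realType.
Implicit Types (Phi Psi : torus R -> torus R) (p q : R * R) (x y : torus R).

Lemma small_intr_eq0 (k : int) : `|k%:~R : R| < 1 -> k = 0.
Proof.
rewrite -intr_norm -[1]/(1%:~R) ltr_int => h; apply/eqP.
by rewrite -normr_eq0; lia.
Qed.

(** Composing the lifts of [Phi] and [Psi] gives a map that is continuous at [p] and
    differs from the identity by integer vectors; near [p] that vector is
    constant, so the composite has the same gradient as the identity. *)
Lemma inverse_jacobian Phi Psi x : cancel Phi Psi -> C1_map Phi -> C1_map Psi ->
  let y := Phi x in
  [/\ partial Psi 0 0 y * partial Phi 0 0 x + partial Psi 0 1 y * partial Phi 1 0 x = 1,
      partial Psi 0 0 y * partial Phi 0 1 x + partial Psi 0 1 y * partial Phi 1 1 x = 0,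
      partial Psi 1 0 y * partial Phi 0 0 x + partial Psi 1 1 y * partial Phi 1 0 x = 0 &
      partial Psi 1 0 y * partial Phi 0 1 x + partial Psi 1 1 y * partial Phi 1 1 x = 1].
Proof.
move=> PhiK cPhi cPsi y; pose p := tcoord x.
have px : tproj p = x by exact: tcoordK.
have [F1 F2] := expands_lift p cPhi; rewrite px in F1 F2.
have Fp : plane_lift Phi p p = tcoord y by rewrite lift_base px.
have [H1 H2] := expands_lift (tcoord y) cPsi; rewrite tcoordK in H1 H2.
set F := plane_lift Phi p in F1 F2 Fp; set H := plane_lift Psi (tcoord y) in H1 H2.
have Fpp : tcoord y = ((F p).1, (F p).2) by rewrite Fp -surjective_pairing.
rewrite Fpp in H1 H2.
have C1 := expands_comp F1 F2 H1; have C2 := expands_comp F1 F2 H2.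
have kP q : exists k : int * int,
    H ((F q).1, (F q).2) = (q.1 + k.1%:~R, q.2 + k.2%:~R).
  apply: tproj_eqP; rewrite -surjective_pairing tproj_lift tproj_lift.
  by rewrite PhiK.
have near (g : R * R -> R) (i : R * R -> R) a b :
    (forall q k1 k2, i (q.1 + k1, q.2 + k2) = i q + i (k1, k2)) ->
    (forall k1 k2 : R, `|i (k1, k2)| <= `|k1| + `|k2|) ->
    (forall k1 k2 : int, exists k : int, i (k1%:~R, k2%:~R) = k%:~R) ->
    g = i \o H ->
    expands (fun q => g ((F q).1, (F q).2)) p a b ->
    expands i p a b.
  move=> iD il iZ gE ge.
  have e0 : (0 : R) < 4^-1 by [].
  have [d d0 dP] := expands_small ge e0.
  apply: (expands_eq_near (d := Num.min d 4^-1) ge); first by rewrite lt_min d0.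
  move=> h1 h2; rewrite !le_min => /andP[a1 b1] /andP[a2 b2].
  have := dP h1 h2 a1 a2; rewrite gE /=.
  have [k ->] := kP (p.1 + h1, p.2 + h2); have [l ->] := kP p.
  rewrite [i (_ + k.1%:~R, _)]iD [i (_ + l.1%:~R, _)]iD.
  have [k' ->] := iZ k.1 k.2; have [l' ->] := iZ l.1 l.2.
  rewrite iD => hk.
  suff -> : k' = l' by ring.
  apply/eqP; rewrite -subr_eq0; apply/eqP/small_intr_eq0; rewrite intrB.
  have -> : (k'%:~R - l'%:~R : R) =
     (i p + i (h1, h2) + k'%:~R - (i p + l'%:~R)) - i (h1, h2) by ring.
  apply: le_lt_trans (ler_normB _ _) _.
  have := il h1 h2; lra.
have fstE (k1 k2 : int) : exists k : int, ((k1%:~R : R), (k2%:~R : R)).1 = k%:~R.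
  by exists k1.
have sndE (k1 k2 : int) : exists k : int, ((k1%:~R : R), (k2%:~R : R)).2 = k%:~R.
  by exists k2.
have lefst (k1 k2 : R) : `|(k1, k2).1| <= `|k1| + `|k2| by rewrite lerDl.
have lesnd (k1 k2 : R) : `|(k1, k2).2| <= `|k1| + `|k2| by rewrite lerDr.
have P1 := near (fun q => (H q).1) (fun q => q.1) _ _ (fun _ _ _ => erefl)
  lefst fstE erefl C1.
have P2 := near (fun q => (H q).2) (fun q => q.2) _ _ (fun _ _ _ => erefl)
  lesnd sndE erefl C2.
have [e1 e2] := expands_unique P1 (expands_fst p).
have [e3 e4] := expands_unique P2 (expands_snd p).
by split; [exact: e1|exact: e2|exact: e3|exact: e4].
Qed.

Lemma lift_continuous Phi p : C1_map Phi -> {for p, continuous (plane_lift Phi p)}.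
Proof.
move=> cPhi; have [/expands_continuous h1 /expands_continuous h2] := expands_lift p cPhi.
apply/cvgrPdist_le => e e0.
have /cvgrPdist_le/(_ e e0) k1 := h1; have /cvgrPdist_le/(_ e e0) k2 := h2.
apply: (@filterS2 _ (nbhs p) (nbhs_filter p) _ _ _ _ k1 k2) => q l1 l2; rewrite prod_normE /= ge_max.
exact/andP.
Qed.

Lemma continuous_comp_torus Phi (f : torus R -> R) : C1_map Phi ->
  continuous (fun p => f (tproj p)) -> continuous (fun p => f (Phi (tproj p))).
Proof.
move=> cPhi cf p.
have -> : (fun q => f (Phi (tproj q))) = (fun q => f (tproj q)) \o plane_lift Phi p.
  by apply/funext => q /=; rewrite tproj_lift.
apply: continuous_comp; [exact: lift_continuous|exact: cf].
Qed.

(** Such a function is lower semicontinuous: the fractional part is continuous off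
    the integers, where it takes its least value [0]. *)
Lemma measurable_fracpart_of_continuous (u : R * R -> R) :
  (forall q, 0 <= u q < 1) ->
  (forall p, exists v : R * R -> R, [/\ {for p, continuous v}, v p = u p &
     forall q, u q = fracpart (v q)]) ->
  measurable_fun setT u.
Proof.
move=> u01 uv; apply: (measurability _ (RGenOInfty.measurableE R)).
move=> _ [B [t ->] <-]; rewrite setTI; apply: open_measurable_prod.
have [t0|t0] := ltP t 0.
  rewrite (_ : _ @^-1` _ = setT); first exact: openT.
  apply/seteqP; split=> // q _ /=; rewrite in_itv /= andbT.
  by have /andP[h _] := u01 q; exact: lt_le_trans t0 h.
rewrite openE => p /=; rewrite in_itv /= andbT => tp.
have [v [cv vp vq]] := uv p; have /andP[_ up1] := u01 p.
have nb : nbhs (v p) `]t, 1[%classic.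
  by apply: near_in_itvoo; rewrite in_itv /= vp tp up1.
suff : nbhs p (u @^-1` `]t, +oo[%classic) by [].
apply: (@filterS _ (nbhs p) (nbhs_filter p) _ _ _ (cv _ nb)) => q /=; rewrite !in_itv /= andbT vq => /andP[h1 h2].
rewrite fracpart_id //.
by apply/andP; split => //; lra.
Qed.

Lemma measurable_tcoord_map Phi : C1_map Phi ->
  measurable_fun setT (fun p : R * R => tcoord (Phi (tproj p))).
Proof.
move=> cPhi.
have -> : (fun p : R * R => tcoord (Phi (tproj p))) =
    (fun p => ((tcoord (Phi (tproj p))).1, (tcoord (Phi (tproj p))).2)).
  by apply/funext => p; rewrite -surjective_pairing.
apply: measurable_fun_pair; apply: measurable_fracpart_of_continuous.
- by move=> q; have [] := tcoord_itv (Phi (tproj q)).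
- move=> p; exists (fun q => (plane_lift Phi p q).1); split.
  + by have [/expands_continuous] := expands_lift p cPhi.
  + by rewrite lift_base.
  + by move=> q; rewrite -(tproj_lift Phi p).
- by move=> q; have [] := tcoord_itv (Phi (tproj q)).
- move=> p; exists (fun q => (plane_lift Phi p q).2); split.
  + by have [_ /expands_continuous] := expands_lift p cPhi.
  + by rewrite lift_base.
  + by move=> q; rewrite -(tproj_lift Phi p).
Qed.

Lemma unit_shifts_small (k1 k2 : int) :
  `|k1%:~R : R| < 2 -> `|k2%:~R : R| < 2 -> (k1%:~R, k2%:~R) \in unit_shifts R.
Proof.
have H (k : int) : `|k%:~R : R| < 2 -> [\/ k = -1, k = 0 | k = 1].
  rewrite -intr_norm -[2]/(2%:~R) ltr_int => h.
  have [|[|]] : k = -1 \/ k = 0 \/ k = 1 by lia.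
  - by constructor 1. - by constructor 2. - by constructor 3.
by move=> /H[->|->|->] /H[->|->|->]; rewrite !(intrN, mulr1z, mulr0z) !inE eqxx ?orbT.
Qed.

(** The representative in the unit square of a point close to [y0] differs from a
    lift close to [y0] by an integer vector with entries [-1], [0] or [1]. *)
Lemma map_near_linear Phi p (eta : R) : C1_map Phi -> 0 < eta ->
  exists2 d : R, 0 < d & forall z : R * R,
    `|z.1 - p.1| <= d -> `|z.2 - p.2| <= d ->
    exists r k : R * R,
      [/\ `|r.1| <= eta * (`|z.1 - p.1| + `|z.2 - p.2|),
          `|r.2| <= eta * (`|z.1 - p.1| + `|z.2 - p.2|), k \in unit_shifts R &
          tcoord (Phi (tproj z)) =
           ((tcoord (Phi (tproj p))).1 + partial Phi 0 0 (tproj p) * (z.1 - p.1)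
              + partial Phi 0 1 (tproj p) * (z.2 - p.2) + r.1 + k.1,
            (tcoord (Phi (tproj p))).2 + partial Phi 1 0 (tproj p) * (z.1 - p.1)
              + partial Phi 1 1 (tproj p) * (z.2 - p.2) + r.2 + k.2)].
Proof.
move=> cPhi eta0; have [E1 E2] := expands_lift p cPhi.
have h0 : (0 : R) < 2^-1 by [].
have [d1 d10 P1] := E1 _ eta0; have [d2 d20 P2] := E2 _ eta0.
have [d3 d30 P3] := expands_small E1 h0; have [d4 d40 P4] := expands_small E2 h0.
exists (Num.min (Num.min d1 d2) (Num.min d3 d4)); first by rewrite !lt_min d10 d20 d30.
move=> z; rewrite !le_min => /andP[/andP[a1 a2] /andP[a3 a4]].
move=> /andP[/andP[b1 b2] /andP[b3 b4]].
have := P1 _ _ a1 b1; have := P2 _ _ a2 b2; have := P3 _ _ a3 b3; have := P4 _ _ a4 b4.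
have -> : (p.1 + (z.1 - p.1), p.2 + (z.2 - p.2)) = z.
  by apply: injective_projections => /=; ring.
set F := plane_lift Phi p.
set y0 := tcoord (Phi (tproj p)); set v1 := z.1 - p.1; set v2 := z.2 - p.2.
move=> s2 s1 r2 r1.
have [k hk] : exists k : int * int, tcoord (Phi (tproj z)) =
    ((F z).1 + k.1%:~R, (F z).2 + k.2%:~R).
  by apply: tproj_eqP; rewrite tcoordK tproj_lift.
have [y1 y2] := tcoord_itv (Phi (tproj p)); rewrite -/y0 in y1 y2.
have [w1 w2] := tcoord_itv (Phi (tproj z)); rewrite hk in w1 w2.
have Fp : F p = y0 by exact: lift_base.
rewrite Fp in r1 r2 s1 s2.
have bound (w y u : R) : 0 <= y < 1 -> 0 <= w + u < 1 -> `|w - y| <= 2^-1 -> `|u| < 2.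
  by rewrite ler_norml ltr_norml; clear; lra.
have split3 (w y u A B : R) : w + u = y + A + B + (w - y - (A + B)) + u.
  by clear; ring.
eexists (_, _), (k.1%:~R, k.2%:~R); split; [exact: r1|exact: r2| |]; last first.
  by rewrite hk; apply: injective_projections; exact: split3.
by apply: unit_shifts_small; [exact: bound y1 w1 s1|exact: bound y2 w2 s2].
Qed.

End torus_maps.

(** * Change of variables inequality *)

Section change_of_variables.
Variable R : realType.
Implicit Types (Phi Psi : torus R -> torus R) (p q : R * R) (x y : torus R).

Definition jac Phi x : R :=
  partial Phi 0 0 x * partial Phi 1 1 x - partial Phi 0 1 x * partial Phi 1 0 x.

Lemma jac_inverse Phi Psi x : cancel Phi Psi -> C1_map Phi -> C1_map Psi ->
  jac Psi (Phi x) * jac Phi x = 1.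
Proof.
move=> PhiK cPhi cPsi; have [] := inverse_jacobian x PhiK cPhi cPsi.
rewrite /jac; set a' := partial Psi 0 0 _; set b' := partial Psi 0 1 _.
set c' := partial Psi 1 0 _; set d' := partial Psi 1 1 _.
set a := partial Phi 0 0 _; set b := partial Phi 0 1 _.
set c := partial Phi 1 0 _; set d := partial Phi 1 1 _.
clearbody a b c d a' b' c' d' => h1 h2 h3 h4.
have -> : (a' * d' - b' * c') * (a * d - b * c) =
  (a' * a + b' * c) * (c' * b + d' * d) - (a' * b + b' * d) * (c' * a + d' * c).
  by ring.
by rewrite h1 h2 h3 h4; ring.
Qed.

Lemma jac_neq0 Phi Psi x : cancel Phi Psi -> C1_map Phi -> C1_map Psi ->
  jac Phi x != 0.
Proof.
move=> PhiK cPhi cPsi; apply/eqP => h.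
by have := jac_inverse x PhiK cPhi cPsi; rewrite h mulr0 => /esym/eqP; rewrite oner_eq0.
Qed.

(** [Psi] being the inverse of [Phi], the condition on [y] says that [y] represents a
    point of the image of the square. *)
Lemma image_small_cell Phi Psi p (e : R) : cancel Psi Phi -> C1_map Phi ->
  jac Phi (tproj p) != 0 -> 0 < e ->
  exists2 d : R, 0 < d & forall a s, 0 < s < d ->
    a.1 <= p.1 <= a.1 + s -> a.2 <= p.2 <= a.2 + s ->
    exists P : set (R * R), [/\ measurable P,
      (lebesgue2 R P <= (36 * (2 * `|jac Phi (tproj p)|%R + e) * s ^+ 2)%:E)%E &
      forall y : R * R, @unit_square R y -> cell a s (tcoord (Psi (tproj y))) -> P y].
Proof.
move=> PsiK cPhi j0 e0; have [eta eta0 H] := linear_image_cover j0 e0.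
have eta2 : 0 < eta / 2 by rewrite divr_gt0.
have [d d0 dP] := map_near_linear p cPhi eta2.
exists d => // a s /andP[s0 sd] pa1 pa2.
have [P [mP lP PP]] := H s (tcoord (Phi (tproj p))) s0.
exists P; split=> // y uy /cellE; set z := tcoord _ => -[z1 z2].
have n1 : `|z.1 - p.1| <= s by rewrite ler_norml; lra.
have n2 : `|z.2 - p.2| <= s by rewrite ler_norml; lra.
have [r [k [r1 r2 kk]]] := dP z (le_trans n1 (ltW sd)) (le_trans n2 (ltW sd)).
rewrite /z tcoordK PsiK tprojK // -/z => yE.
have rs (t : R) : `|t| <= eta / 2 * (`|z.1 - p.1| + `|z.2 - p.2|) -> `|t| <= eta * s.
  move=> h; apply: le_trans h _.
  have -> : eta * s = eta / 2 * (s + s) by field.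
  by rewrite ler_pM2l // lerD.
exact: PP n1 n2 (rs _ r1) (rs _ r2) kk yE.
Qed.

Lemma ball_cell (a p z : R * R) (s d : R) :
  a.1 <= p.1 <= a.1 + s -> a.2 <= p.2 <= a.2 + s -> s < d ->
  cell a s z -> ball p d z.
Proof.
have H (u v w : R) : u <= v <= u + s -> s < d -> u <= w < u + s -> `|v - w| < d.
  by rewrite ltr_norml; clear; lra.
by move=> pa1 pa2 sd /cellE[z1 z2]; split; [exact: H pa1 sd z1|exact: H pa2 sd z2].
Qed.

(** One half of the change of variables formula, with a lossy constant: as
    [72 = 2 * 36], the constants are those of [image_small_cell].  By bisection
    it suffices to compare the two integrals on squares shrinking to a point;
    adding an arbitrary [eta] to the integrand on the right absorbs the errors
    made there. *)
Lemma integral_image_le Phi Psi (f w : torus R -> R) :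
  cancel Phi Psi -> cancel Psi Phi -> C1_map Phi -> C1_map Psi ->
  continuous (fun p => f (tproj p)) -> continuous (fun p => w (tproj p)) ->
  (forall y, 0 <= f y) -> (forall x, f (Phi x) * `|jac Phi x| <= w x) ->
  (\int[lebesgue2 R]_(p in @unit_square R) (f (tproj p))%:E
    <= 72%:E * \int[lebesgue2 R]_(p in @unit_square R) (w (tproj p))%:E)%E.
Proof.
move=> PhiK PsiK cPhi cPsi cf cw f0 fw.
have w0 x : 0 <= w x by apply: le_trans (fw x); rewrite mulr_ge0.
have mf := measurable_EFin_continuous cf; have mw := measurable_EFin_continuous cw.
pose T (y : R * R) := tcoord (Psi (tproj y)).
have mT : measurable_fun setT T by exact: measurable_tcoord_map.
have mU := @measurable_unit_square R.
pose F A : \bar R := (\int[lebesgue2 R]_(p in @unit_square R `&` T @^-1` A) (f (tproj p))%:E)%E.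
pose We (eta : R) (p : R * R) : \bar R := (72 * w (tproj p) + eta)%:E.
have mWe eta : measurable_fun setT (We eta).
  apply/measurable_EFinP; apply: measurable_funD => //.
  by apply: measurable_funM => //; exact: continuous_measurable_prod.
pose W eta A : \bar R := (\int[lebesgue2 R]_(p in setT `&` id @^-1` A) We eta p)%E.
have key eta : 0 < eta -> forall a s, 0 < s -> (F (cell a s) <= W eta (cell a s))%E.
  move=> eta0; apply: cousin_cell.
    move=> a s s0 h00 h10 h01 h11.
    have We0 q : (0 <= We eta q)%E by rewrite lee_fin addr_ge0 ?mulr_ge0 // ltW.
    have fe0 (q : R * R) : (0 <= (f (tproj q))%:E)%E by rewrite lee_fin.
    rewrite /F (integral_preimage_cell_split a mU mT mf fe0 s0).
    rewrite /W (integral_preimage_cell_split (T := id) a measurableT _ (mWe eta) We0 s0) //.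
    exact: leeD (leeD h00 h10) (leeD h01 h11).
  move=> p; set x := tproj p.
  have [K K0 etaK] : exists2 K : R, 0 < K & 144 * (eta / K) = eta.
    by exists 144 => //; rewrite mulrC divfK.
  (* [e] and [e'] make the three error terms at [x] add up to at most [eta]. *)
  pose fy := f (Phi x); pose e := eta / (K * (fy + 1)); pose D := `|jac Phi x|.
  have fy0 : 0 <= fy by exact: f0.
  have e0 : 0 < e by rewrite divr_gt0 // mulr_gt0 // ltr_wpDl.
  pose e' := eta / (K * (2 * D + e)).
  have De0 : 0 < 2 * D + e by rewrite ltr_wpDl // mulr_ge0 // normr_ge0.
  have e'0 : 0 < e' by rewrite divr_gt0 // mulr_gt0.
  have j0 := jac_neq0 x PhiK cPhi cPsi.
  have [d d0 dP] := image_small_cell PsiK cPhi j0 e0.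
  have eta2 : 0 < eta / K by rewrite divr_gt0.
  have cfPhi := continuous_comp_torus cPhi cf.
  have nb1 : nbhs p [set q | `|fy - f (Phi (tproj q))| <= e'].
    by have /cvgrPdist_le/(_ _ e'0) := cfPhi p.
  have nb2 : nbhs p [set q | `|w x - w (tproj q)| <= eta / K].
    by have /cvgrPdist_le/(_ _ eta2) := cw p.
  move: nb1 nb2 => /nbhs_ballP[d1 /= d10 P1] /nbhs_ballP[d2 /= d20 P2].
  exists (Num.min d (Num.min d1 d2)); first by rewrite !lt_min d0 d10.
  move=> a s /andP[s0]; rewrite !lt_min => /andP[sd /andP[sd1 sd2]] pa1 pa2.
  have [P [mP lP PP]] := dP a s (introT andP (conj s0 sd)) pa1 pa2.
  have near z (d' : R) : s < d' -> cell a s z -> ball p d' z.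
    by move=> sd' az; exact: ball_cell pa1 pa2 sd' az.
  pose c := 36 * (fy + e') * (2 * D + e).
  have mUT : measurable (@unit_square R `&` T @^-1` cell a s).
    apply: measurableI => //; rewrite -[X in measurable X]setTI.
    by apply: mT => //; exact: measurable_cell.
  apply: (@le_trans _ _ (c * s ^+ 2)%:E).
    apply: (@le_trans _ _ (\int[lebesgue2 R]_(p in @unit_square R `&` T @^-1` cell a s) (fy + e')%:E)%E).
      apply: ge0_le_integral => //.
      - by move=> q _; rewrite lee_fin.
      - exact: measurable_funTS.
      - move=> q [uq Tq]; rewrite lee_fin.
        have := P1 _ (near _ _ sd1 Tq); rewrite /T /= tcoordK PsiK.
        by rewrite ler_norml; lra.
    rewrite integral_cst //.
    have -> : c * s ^+ 2 = (fy + e') * (36 * (2 * D + e) * s ^+ 2) by rewrite /c; ring.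
    rewrite EFinM lee_wpmul2l //; first by rewrite lee_fin addr_ge0 // ltW.
    apply: le_trans lP; apply: le_measure; rewrite ?inE //.
    by move=> q [uq Tq]; exact: PP.
  apply: (@le_trans _ _ (\int[lebesgue2 R]_(q in cell a s) c%:E)%E).
    rewrite integral_cst; last exact: measurable_cell.
    by rewrite [X in (_ * X)%E](measure_cell a (ltW s0)) -EFinM lexx.
  rewrite /W setTI preimage_id.
  apply: ge0_le_integral => //.
  - exact: measurable_cell.
  - by move=> q _; rewrite lee_fin /c mulr_ge0 ?(ltW De0) // mulr_ge0 // addr_ge0 // ltW.
  - by apply: measurable_funTS; exact: mWe.
  - move=> q cq; rewrite lee_fin.
    have h1 : `|w x - w (tproj q)| <= eta / K := P2 _ (near _ _ sd2 cq).
    have h2 : fy * D <= w x := fw x.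
    have h3 : e' * (2 * D + e) = eta / K by rewrite /e'; field; rewrite !gt_eqF.
    have h4 : fy * e <= eta / K.
      rewrite /e.
      have fy1 : 0 < fy + 1 by rewrite ltr_wpDl.
      have -> : fy * (eta / (K * (fy + 1))) = eta / K * (fy / (fy + 1)).
        by field; rewrite !gt_eqF.
      by rewrite -[leRHS]mulr1 ler_pM2l ?divr_gt0 // ler_pdivrMr // mul1r lerDl.
    have -> : c = 72 * (fy * D) + 36 * (fy * e) + 36 * (e' * (2 * D + e)) by rewrite /c; ring.
    by move: h1; rewrite h3 ler_norml; lra.
apply/lee_addgt0Pr => eta eta0.
have := key _ eta0 (0, 0) 1 ltr01; rewrite -unit_squareE /F /W.
have -> : @unit_square R `&` T @^-1` @unit_square R = @unit_square R.
  apply/seteqP; split=> [q [] //|q uq]; split=> //; rewrite /T /unit_square /=.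
  by have [h1 h2] := tcoord_itv (Psi (tproj q)); apply/andP.
rewrite setTI preimage_id => h; apply: le_trans h _.
rewrite /We.
under eq_integral do rewrite EFinD EFinM.
rewrite ge0_integralD //.
- rewrite ge0_integralZl //.
  + rewrite integral_cst // [X in (_ + _ * X)%E]measure_unit_square.
    by rewrite mule1 lexx.
  + exact: measurable_funTS.
- by move=> q _; rewrite lee_fin.
- by move=> q _; rewrite mule_ge0 // lee_fin.
- by apply: measurable_funTS; apply: measurable_funeM; exact: mw.
- by move=> q _; rewrite lee_fin ltW.
Qed.

End change_of_variables.

(** * Poincare inequality on a square *)

Section poincare.
Variable R : realType.
Notation mu := (@lebesgue_measure R).
Local Open Scope ereal_scope.

Lemma dist_le_integral_derive (f f' : R -> R) (a s x y : R) :
  (forall t : R, is_derive t 1%R f (f' t)) -> continuous f' ->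
  (a <= x < a + s)%R -> (a <= y < a + s)%R ->
  `|f x - f y|%:E <= \int[mu]_(t in `[a, (a + s)%R[) `|f' t|%:E.
Proof.
move=> df cf'.
have cf : continuous f.
  move=> t; apply/differentiable_continuous/derivable1_diffP.
  by have := df t; case.
have mf' : measurable_fun setT f' by exact: continuous_measurable_fun.
have mnf' : measurable_fun setT (fun t => `|f' t|%:E).
  by apply/measurable_EFinP; apply: measurableT_comp.
have H (u v : R) : (a <= u)%R -> (u < v)%R -> (v < a + s)%R ->
    `|f v - f u|%:E <= \int[mu]_(t in `[a, (a + s)%R[) `|f' t|%:E.
  move=> au uv vs.
  have e : \int[mu]_(t in `[u, v]) (f' t)%:E = (f v)%:E - (f u)%:E.
    apply: continuous_FTC2 => //.
    - exact: continuous_subspaceT.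
    - split.
      + by move=> t _; have := df t; case.
      + by apply: cvg_at_right_filter; exact: cf.
      + by apply: cvg_at_left_filter; exact: cf.
    - by move=> t _; rewrite derive1E; apply: derive_val.
  rewrite -[leLHS]/(`|(f v - f u)%:E|) EFinB -e.
  apply: le_trans (le_abse_integral _ _ _) _ => //.
    by apply: measurable_funTS; exact/measurable_EFinP.
  apply: ge0_subset_integral => //; first exact: measurable_funTS.
  by move=> t /=; rewrite !in_itv /= => /andP[h1 h2]; apply/andP; split; lra.
move=> /andP[x1 x2] /andP[y1 y2].
have [xy|yx|->] := ltgtP x y; first by rewrite distrC; exact: H.
  exact: H.
by rewrite subrr normr0; apply: integral_ge0.
Qed.

Lemma integral_cell_fst_le (k : R -> \bar R) (a : R * R) (s : R) :
  (0 < s)%R -> measurable_fun setT k -> (forall x, 0 <= k x) ->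
  \int[lebesgue2 R]_(p in cell a s) k p.1 <= s%:E * \int[mu]_x k x.
Proof.
move=> s0 mk k0; have mc := measurable_cell a s.
rewrite integral_mkcond.
have mf : measurable_fun setT ((fun p : R * R => k p.1) \_ (cell a s)).
  apply/(measurable_restrictT _ mc); apply: measurable_funTS.
  exact: measurableT_comp.
rewrite fubini_tonelli1 //; last by move=> p; exact: erestrict_ge0.
rewrite -ge0_integralZl //; last by rewrite lee_fin ltW.
apply: ge0_le_integral => //.
- by move=> x _; apply: integral_ge0 => y _; exact: erestrict_ge0.
- by apply: measurable_fun_fubini_tonelli_F => // p; exact: erestrict_ge0.
- exact: measurable_funeM.
move=> x _; rewrite /fubini_F.
apply: (@le_trans _ _ (\int[mu]_(y in `[a.2, (a.2 + s)%R[) cst (k x) y)).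
  rewrite [leRHS]integral_mkcond; apply: ge0_le_integral => //.
  - by move=> y _; exact: erestrict_ge0.
  - by apply: (@measurable_fun_pair2 _ _ _ _ _ _ _ x mf).
  - by apply/(measurable_restrictT _ (measurable_itv _)); exact: measurable_cst.
  - move=> y _; rewrite /patch; case: ifPn => [|_].
      rewrite inE => /cellE[_ h2]; rewrite ifT //.
      by rewrite inE /= in_itv.
    by case: ifP => _; [exact: k0|exact: lexx].
rewrite integral_cst // muleC lee_wpmul2r //.
by rewrite [leLHS](lebesgue_measure_co _ (ltW s0)).
Qed.

Lemma integral_cell_snd_le (k : R -> \bar R) (a : R * R) (s : R) :
  (0 < s)%R -> measurable_fun setT k -> (forall x, 0 <= k x) ->
  \int[lebesgue2 R]_(p in cell a s) k p.2 <= s%:E * \int[mu]_x k x.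
Proof.
move=> s0 mk k0; have mc := measurable_cell a s.
rewrite integral_mkcond.
have mf : measurable_fun setT ((fun p : R * R => k p.2) \_ (cell a s)).
  apply/(measurable_restrictT _ mc); apply: measurable_funTS.
  exact: measurableT_comp.
have f0 (p : R * R) : 0 <= ((fun p : R * R => k p.2) \_ (cell a s)) p.
  exact: erestrict_ge0.
rewrite fubini_tonelli1 // /fubini_F fubini_tonelli //.
rewrite -ge0_integralZl //; last by rewrite lee_fin ltW.
apply: ge0_le_integral => //.
- by move=> x _; apply: integral_ge0 => y _; exact: erestrict_ge0.
- by apply: measurable_fun_fubini_tonelli_G => // p; exact: erestrict_ge0.
- exact: measurable_funeM.
move=> y _.
apply: (@le_trans _ _ (\int[mu]_(x in `[a.1, (a.1 + s)%R[) cst (k y) x)).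
  rewrite [leRHS]integral_mkcond; apply: ge0_le_integral => //.
  - by apply: (@measurable_fun_pair1 _ _ _ _ _ _ _ y mf).
  - by apply/(measurable_restrictT _ (measurable_itv _)); exact: measurable_cst.
  - move=> x _; rewrite /patch; case: ifPn => [|_].
      rewrite inE => /cellE[h1 _]; rewrite ifT //.
      by rewrite inE /= in_itv.
    by case: ifP => _; [exact: k0|exact: lexx].
rewrite integral_cst // muleC lee_wpmul2r //.
by rewrite [leLHS](lebesgue_measure_co _ (ltW s0)).
Qed.

End poincare.

Section poincare_cell.
Variable R : realType.
Notation mu := (@lebesgue_measure R).
Local Open Scope ereal_scope.

Lemma continuous_slice1 (f : R * R -> R) (y : R) :
  continuous f -> continuous (fun t => f (t, y)).
Proof.
move=> cf t; apply: (@continuous_comp _ _ _ (fun t => (t, y)) f); last exact: cf.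
apply/cvgrPdist_le => e e0; apply: filterS (nbhsx_ballx t e e0) => u /= tu.
by rewrite prod_normE /= subrr normr0 ge_max (ltW e0) andbT ltW.
Qed.

Lemma continuous_slice2 (f : R * R -> R) (x : R) :
  continuous f -> continuous (fun t => f (x, t)).
Proof.
move=> cf t; apply: (@continuous_comp _ _ _ (fun t => (x, t)) f); last exact: cf.
apply/cvgrPdist_le => e e0; apply: filterS (nbhsx_ballx t e e0) => u /= tu.
by rewrite prod_normE /= subrr normr0 ge_max (ltW e0) /= ltW.
Qed.

(** An L1 Poincare inequality without mean value, for functions that are
    nonpositive, and also nonnegative, on a proportion [c] of the square.  Any two points of the square
    are joined by a horizontal and then a vertical segment, and the variation
    of [g] along them is averaged over the end point of opposite sign. *)
Lemma poincare_cell (g D1 D2 : R * R -> R) (a : R * R) (s c : R) :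
  (0 < s)%R -> (0 < c)%R ->
  continuous g -> continuous D1 -> continuous D2 ->
  (forall p : R * R, is_derive p.1 1%R (fun t => g (t, p.2)) (D1 p)) ->
  (forall p : R * R, is_derive p.2 1%R (fun t => g (p.1, t)) (D2 p)) ->
  (forall sg : bool, exists N : set (R * R), [/\ measurable N, N `<=` cell a s,
     (c * s ^+ 2)%:E <= lebesgue2 R N &
     forall z, N z -> (0 <= (-1) ^+ sg * g z)%R]) ->
  c%:E * \int[lebesgue2 R]_(p in cell a s) `|g p|%:E
   <= s%:E * (\int[lebesgue2 R]_(p in cell a s) `|D1 p|%:E
              + \int[lebesgue2 R]_(p in cell a s) `|D2 p|%:E).
Proof.
move=> s0 c0 cg cD1 cD2 dg1 dg2 HN; have mc := measurable_cell a s.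
have mabs (f : R * R -> R) : continuous f -> measurable_fun setT (fun p => `|f p|%:E).
  move=> cf; apply/measurable_EFinP; apply: measurableT_comp => //.
  exact: continuous_measurable_prod.
pose h (D : R * R -> R) := (fun p => `|D p|%:E) \_ (cell a s).
have mh D : continuous D -> measurable_fun setT (h D).
  move=> cD; apply/(measurable_restrictT _ mc); apply: measurable_funTS.
  exact: mabs.
have h0 D p : 0 <= h D p by apply: erestrict_ge0 => q _; rewrite lee_fin.
pose V := fubini_G mu (h D1); pose W := fubini_F mu (h D2).
have mV : measurable_fun setT V by apply: measurable_fun_fubini_tonelli_G; [exact: mh|exact: h0].
have mW : measurable_fun setT W by apply: measurable_fun_fubini_tonelli_F; [exact: mh|exact: h0].
have V0 y : 0 <= V y by apply: integral_ge0 => x _; exact: h0.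
have W0 x : 0 <= W x by apply: integral_ge0 => y _; exact: h0.
set A1 := \int[lebesgue2 R]_(p in _) `|D1 p|%:E.
set A2 := \int[lebesgue2 R]_(p in _) `|D2 p|%:E.
have A1E : \int[mu]_y V y = A1.
  rewrite /A1 [RHS]integral_mkcond fubini_tonelli1; [|exact: mh|exact: h0].
  by rewrite /fubini_F fubini_tonelli; [|exact: mh|exact: h0].
have A2E : \int[mu]_x W x = A2.
  by rewrite /A2 [RHS]integral_mkcond fubini_tonelli1; [|exact: mh|exact: h0].
have A10 : 0 <= A1 by apply: integral_ge0 => p _; rewrite lee_fin.
have A20 : 0 <= A2 by apply: integral_ge0 => p _; rewrite lee_fin.
have path y z : cell a s y -> cell a s z -> `|g y - g z|%:E <= V y.2 + W z.1.
  move=> /cellE[y1 y2] /cellE[z1 z2].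
  have e1 : V y.2 = \int[mu]_(t in `[a.1, (a.1 + s)%R[) `|D1 (t, y.2)|%:E.
    rewrite [RHS]integral_mkcond; apply: eq_integral => t _.
    rewrite /h /patch; congr (if _ then _ else _).
    apply/idP/idP; rewrite !inE cellE /= in_itv /=; first by case.
    by [].
  have e2 : W z.1 = \int[mu]_(t in `[a.2, (a.2 + s)%R[) `|D2 (z.1, t)|%:E.
    rewrite [RHS]integral_mkcond; apply: eq_integral => t _.
    rewrite /h /patch; congr (if _ then _ else _).
    apply/idP/idP; rewrite !inE cellE /= in_itv /=; first by case.
    by [].
  have v1 := @dist_le_integral_derive R (fun t => g (t, y.2)) (fun t => D1 (t, y.2))
    a.1 s y.1 z.1 (fun t => dg1 (t, y.2))
    (@continuous_slice1 _ y.2 cD1) y1 z1.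
  have v2 := @dist_le_integral_derive R (fun t => g (z.1, t)) (fun t => D2 (z.1, t))
    a.2 s y.2 z.2 (fun t => dg2 (z.1, t))
    (@continuous_slice2 _ z.1 cD2) y2 z2.
  rewrite e1 e2; apply: le_trans (leeD v1 v2).
  rewrite -EFinD lee_fin -!surjective_pairing.
  have -> : (g y - g z = (g y - g (z.1, y.2)) + (g (z.1, y.2) - g z))%R by ring.
  exact: ler_normD.
have mVc : measurable_fun setT (fun p : R * R => V p.2) by exact: measurableT_comp.
have mWc : measurable_fun setT (fun p : R * R => W p.1) by exact: measurableT_comp.
have iW : \int[lebesgue2 R]_(p in cell a s) W p.1 <= s%:E * A2.
  by rewrite -A2E; exact: integral_cell_fst_le.
have iV : \int[lebesgue2 R]_(p in cell a s) V p.2 <= s%:E * A1.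
  by rewrite -A1E; exact: integral_cell_snd_le.
have ptw y : cell a s y ->
    (c * s ^+ 2)%:E * `|g y|%:E <= (s ^+ 2)%:E * V y.2 + s%:E * A2.
  move=> cy.
  have [N [mN Nc lN sN]] := HN (0 <= g y)%R.
  apply: (@le_trans _ _ (\int[lebesgue2 R]_(z in N) `|g y|%:E)).
    by rewrite integral_cst // muleC; apply: lee_wpmul2l; rewrite ?lee_fin.
  apply: (@le_trans _ _ (\int[lebesgue2 R]_(z in cell a s) (V y.2 + W z.1))).
    apply: (@le_trans _ _ (\int[lebesgue2 R]_(z in N) (V y.2 + W z.1))).
      apply: ge0_le_integral => //.
      - by apply: measurable_funTS; apply: emeasurable_funD.
      - move=> z Nz; apply: le_trans (path y z cy (Nc _ Nz)).
        have := sN z Nz; rewrite lee_fin.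
        case: (leP 0%R (g y)) => gy /=.
          rewrite expr1 mulN1r => gz; rewrite !ger0_norm //; lra.
        rewrite expr0 mul1r => gz.
        rewrite ltr0_norm // distrC ger0_norm; lra.
    apply: ge0_subset_integral => //.
      by apply: measurable_funTS; apply: emeasurable_funD.
    by move=> z _; apply: adde_ge0.
  rewrite ge0_integralD //; last exact: measurable_funTS.
  rewrite integral_cst // [X in V y.2 * X](measure_cell a (ltW s0)) muleC.
  by apply: leeD.
rewrite -(@lee_pmul2l _ (s ^+ 2)%:E) //; last by rewrite lte_fin exprn_gt0.
have -> : (s ^+ 2)%:E * (c%:E * \int[lebesgue2 R]_(p in cell a s) `|g p|%:E) =
    \int[lebesgue2 R]_(p in cell a s) ((c * s ^+ 2)%:E * `|g p|%:E).
  rewrite ge0_integralZl ?lee_fin ?mulr_ge0 ?(ltW s0) ?(ltW c0) //.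
    by rewrite muleA -EFinM mulrC.
  by apply: measurable_funTS; exact: mabs.
apply: (@le_trans _ _ (\int[lebesgue2 R]_(y in cell a s)
    ((s ^+ 2)%:E * V y.2 + s%:E * A2))).
  apply: ge0_le_integral => //.
  - by move=> y _; rewrite mule_ge0 // lee_fin mulr_ge0 // ?sqr_ge0 // ltW.
  - by apply: measurable_funeM; apply: measurable_funTS; exact: mabs.
  - apply: measurable_funTS; apply: emeasurable_funD => //.
    exact: measurable_funeM.
have sE : 0 <= s%:E by rewrite lee_fin ltW.
have s2E : 0 <= (s ^+ 2)%:E by rewrite lee_fin sqr_ge0.
rewrite ge0_integralD //; last first.
- by move=> y _; rewrite mule_ge0.
- by apply: measurable_funTS; apply: measurable_funeM.
- by move=> y _; rewrite mule_ge0.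
rewrite ge0_integralZl //; last exact: measurable_funTS.
rewrite integral_cst // [X in s%:E * A2 * X](measure_cell a (ltW s0)).
have -> : (s ^+ 2)%:E * (s%:E * (A1 + A2)) =
    (s ^+ 2)%:E * (s%:E * A1) + (s ^+ 2)%:E * (s%:E * A2).
  by rewrite (ge0_muleDr _ A10 A20) (ge0_muleDr _ (mule_ge0 sE A10) (mule_ge0 sE A20)).
apply: leeD; last by rewrite muleC.
exact: lee_wpmul2l.
Qed.

End poincare_cell.

(** * Mixing at the scale of a square *)

Section mixing.
Variable R : realType.
Implicit Types (Phi Psi : torus R -> torus R) (p q : R * R) (x y : torus R).

Lemma cell_subdivision (good : R * R -> R -> Prop) :
  (forall a s, 0 < s -> good a (s / 2) -> good (a.1 + s / 2, a.2) (s / 2) ->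
     good (a.1, a.2 + s / 2) (s / 2) ->
     good (a.1 + s / 2, a.2 + s / 2) (s / 2) -> good a s) ->
  forall n a s, 0 < s ->
   (forall b : R * R, a.1 <= b.1 -> b.1 + s / 2 ^+ n <= a.1 + s ->
      a.2 <= b.2 -> b.2 + s / 2 ^+ n <= a.2 + s -> good b (s / 2 ^+ n)) ->
   good a s.
Proof.
move=> step; elim=> [|n ih] a s s0 H.
  by have := H a; rewrite expr0 divr1 !lexx; apply.
have s20 : 0 < s / 2 by rewrite divr_gt0.
have sE : s / 2 ^+ n.+1 = s / 2 / 2 ^+ n by rewrite exprS invfM mulrA.
by apply: step => //; apply: ih => // b /= h1 h2 h3 h4; rewrite -sE; apply: H;
  rewrite ?sE; lra.
Qed.

Lemma image_tcoord (S : set (torus R)) :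
  @tcoord R @` S = @unit_square R `&` (@tproj R) @^-1` S.
Proof.
apply/seteqP; split=> [p [x Sx <-]|p [up Sp]].
  split; last by rewrite /preimage /= tcoordK.
  by have [h1 h2] := tcoord_itv x; apply/andP.
by exists (tproj p) => //; exact: tprojK.
Qed.

Lemma euclid_norm_lt (v : R * R) (e : R) : 0 < e ->
  (euclid_norm v < e) = (v.1 ^+ 2 + v.2 ^+ 2 < e ^+ 2).
Proof.
move=> e0; rewrite /euclid_norm -[X in _ < X](ger0_norm (ltW e0)) -sqrtr_sqr.
by rewrite ltr_sqrt // exprn_gt0.
Qed.

Lemma euclid_norm_ge (v : R * R) : `|v.1| <= euclid_norm v /\ `|v.2| <= euclid_norm v.
Proof.
rewrite /euclid_norm -!sqrtr_sqr; split; apply: ler_wsqrtr.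
  by rewrite lerDl sqr_ge0.
by rewrite lerDr sqr_ge0.
Qed.

(** A ball contained in the unit square does not wrap around the torus. *)
Lemma flat_ball_inner (c p : R * R) (e : R) : 0 < e ->
  e <= c.1 <= 1 - e -> e <= c.2 <= 1 - e -> @unit_square R p ->
  flat_ball (tproj c) e (tproj p) <-> euclid_norm (p - c) < e.
Proof.
move=> e0 c1 c2 up.
have uc : @unit_square R c by rewrite /unit_square /= /in_unit_square; lra.
rewrite /flat_ball /flat_dist /mkset (tprojK up) (tprojK uc).
set S := [set _ | _ in _].
have NE : euclid_norm (p - c) = euclid_norm (c - p).
  by rewrite /euclid_norm /=; congr Num.sqrt; ring.
have S0 : S (euclid_norm (c - p)) by exists (0, 0) => //; rewrite addr0.
have lbS : lbound S 0 by move=> _ [k _ <-]; exact: sqrtr_ge0.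
split=> [h|h]; last first.
  by apply: le_lt_trans h; rewrite NE; apply: ge_inf => //; exists 0.
have hinf : has_inf S by split; [exists (euclid_norm (c - p))|exists 0].
have [_ [k _ <-]] : exists2 z, S z & z < e.
  have := inf_adherent (eps := e - inf S) _ hinf; rewrite subr_gt0 => /(_ h) [z Sz].
  by rewrite subrKC => ?; exists z.
move=> kl; have [/= k1 k2] := euclid_norm_ge (c - p + (k.1%:~R, k.2%:~R)).
move: up; rewrite /unit_square /in_unit_square /= => /andP[p1 p2].
have z1 : k.1 = 0.
  by apply: (@small_intr_eq0 R); move: (le_lt_trans k1 kl); rewrite !ltr_norml; lra.
have z2 : k.2 = 0.
  by apply: (@small_intr_eq0 R); move: (le_lt_trans k2 kl); rewrite !ltr_norml; lra.
by move: kl; rewrite z1 z2 addr0 NE.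
Qed.

(** The ball of radius [eps] inscribed at the centre of the square has a definite
    proportion of its area, and mixing says that [Phi A] and its complement
    both have a proportion [kappa] of the ball. *)
Lemma mixing_cell Phi Psi (kappa eps : R) (b : R * R) (t : R) :
  cancel Phi Psi -> cancel Psi Phi -> C1_map Psi -> 0 < kappa < 1 -> 0 < eps ->
  mixes kappa eps Phi (@half_torus R) ->
  2 * eps <= t -> t <= 4 * eps ->
  0 <= b.1 -> b.1 + t <= 1 -> 0 <= b.2 -> b.2 + t <= 1 ->
  forall sg : bool, exists N : set (R * R), [/\ measurable N, N `<=` cell b t,
     ((kappa / 64 * t ^+ 2)%:E <= lebesgue2 R N)%E &
     forall z, N z ->
       if sg then 2^-1 <= (tcoord (Psi (tproj z))).2
       else (tcoord (Psi (tproj z))).2 < 2^-1].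
Proof.
move=> PhiK PsiK cPsi kap e0 mix te te' b1 b1' b2 b2' sg.
pose c : R * R := (b.1 + t / 2, b.2 + t / 2); pose x := tproj c.
pose B := @unit_square R `&` [set p | euclid_norm (p - c) < eps].
pose u p := (tcoord (Psi (tproj p))).2.
pose L := [set p | u p < 2^-1].
have ballE : @tcoord R @` flat_ball x eps = B.
  rewrite image_tcoord; apply/seteqP; split=> p [up hp]; split=> //.
    by apply/(flat_ball_inner e0 _ _ up) => //=; lra.
  by apply/(flat_ball_inner e0 _ _ up) => //=; lra.
have ballAE : @tcoord R @` (flat_ball x eps `&` Phi @` @half_torus R) = B `&` L.
  rewrite -ballE !image_tcoord; apply/seteqP; split.
    move=> p [up [bp [z zA zp]]]; split; first by split.
    rewrite /L /u /= -zp PhiK; by case/andP: zA.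
  move=> p [[up bp] Lp]; split=> //; split=> //.
  exists (Psi (tproj p)); last exact: PsiK.
  by have [_ /andP[h _]] := tcoord_itv (Psi (tproj p)); apply/andP.
have mU := @measurable_unit_square R.
have mB : measurable B.
  apply: measurableI => //.
  pose f p := (p.1 - c.1) ^+ 2 + (p.2 - c.2) ^+ 2.
  have -> : [set p : R * R | euclid_norm (p - c) < eps] = f @^-1` `]-oo, eps ^+ 2[.
    by apply/seteqP; split=> p /=; rewrite in_itv /= euclid_norm_lt.
  rewrite -[X in measurable X]setTI.
  have mf : measurable_fun setT f.
    by apply: measurable_funD; apply: measurable_funX; apply: measurable_funB.
  exact: mf.
have mL : measurable L.
  have -> : L = u @^-1` `]-oo, 2^-1[ by apply/seteqP; split=> p /=; rewrite in_itv.
  rewrite -[X in measurable X]setTI.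
  have mu : measurable_fun setT u.
    exact: measurableT_comp (measurable_tcoord_map cPsi).
  exact: mu.
have Bcell : B `<=` cell b t.
  move=> p [_ /=]; have [/= h1 h2] := euclid_norm_ge (p - c) => h.
  move: (le_lt_trans h1 h) (le_lt_trans h2 h); rewrite !ltr_norml cellE /c /=; lra.
have lB : ((t ^+ 2 / 64)%:E <= lebesgue2 R B)%E.
  pose a : R * R := (b.1 + t / 2, b.2 + t / 2).
  have t8 : 0 <= t / 8 by lra.
  apply: (@le_trans _ _ (lebesgue2 R (cell a (t / 8)))).
    by rewrite measure_cell // lee_fin exprMn exprVn; lra.
  apply: le_measure; rewrite ?inE //; first exact: measurable_cell.
  move=> p; rewrite cellE /a /= => -[h1 h2]; split.
    rewrite /unit_square /= /in_unit_square; lra.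
  rewrite /= euclid_norm_lt // /c /=.
  have sq (v w : R) : w <= v < w + t / 8 -> (v - w) ^+ 2 <= (t / 8) ^+ 2.
    by move=> h; rewrite ler_sqr ?nnegrE; lra.
  have te2 : (t / 8) ^+ 2 <= (eps / 2) ^+ 2 by rewrite ler_sqr ?nnegrE; lra.
  have e2 : 0 < (eps / 2) ^+ 2 by rewrite exprn_gt0 // divr_gt0.
  have -> : eps ^+ 2 = 4 * (eps / 2) ^+ 2 by field.
  by have := sq _ _ h1; have := sq _ _ h2; lra.
have fB : (lebesgue2 R B < +oo)%E.
  apply: (@le_lt_trans _ _ (lebesgue2 R (cell b t))).
    by apply: le_measure; rewrite ?inE //; exact: measurable_cell.
  by rewrite measure_cell ?ltry //; lra.
have [m1 m2] := mix x.
rewrite /area ballE ballAE in m1 m2.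
have kB : ((kappa / 64 * t ^+ 2)%:E <= kappa%:E * lebesgue2 R B)%E.
  have -> : kappa / 64 * t ^+ 2 = kappa * (t ^+ 2 / 64) by ring.
  by rewrite EFinM; apply: lee_wpmul2l => //; rewrite lee_fin; lra.
case: sg; last first.
  exists (B `&` L); split.
  - exact: measurableI.
  - by move=> p [/Bcell].
  - exact: le_trans kB m1.
  - by move=> z [].
exists (B `\` L); split.
- exact: measurableD.
- by move=> p [/Bcell].
- apply: le_trans kB _.
  have DE : lebesgue2 R (B `\` L) = (lebesgue2 R B - lebesgue2 R (B `&` L))%E.
    exact: measureD.
  rewrite [leRHS]DE.
  have : lebesgue2 R B \is a fin_num by rewrite ge0_fin_numE // measure_ge0.
  have : lebesgue2 R (B `&` L) \is a fin_num.
    rewrite ge0_fin_numE ?measure_ge0 //; apply: le_lt_trans fB.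
    by apply: le_measure; rewrite ?inE //; exact: measurableI.
  move: m2; case: (lebesgue2 R B) => // l; case: (lebesgue2 R _) => // l' + _ _.
  rewrite -EFinB -!EFinM !lee_fin; lra.
- by move=> z [_ /= /negP]; rewrite -leNgt.
Qed.

End mixing.

(** * A height function *)

Section height.
Variable R : realType.
Implicit Types (Phi Psi : torus R -> torus R) (p q : R * R) (x y : torus R).

(** Up to the circles where it vanishes, its sign tells the half torus from its
    complement; being smooth and periodic, it can be composed with a map of the
    torus without choosing a lift. *)
Definition height x : R := sin (2 * pi * (tcoord x).2).

Lemma periodic_intr (f : R -> R) : periodic f (pi *+ 2) ->
  forall t (k : int), f (2 * pi * (t + k%:~R)) = f (2 * pi * t).
Proof.
move=> pf t k.
have H (u : R) (n : nat) : f (2 * pi * (u + n%:R)) = f (2 * pi * u).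
  rewrite -(periodicn pf n (2 * pi * u)); congr f.
  by rewrite -mulr_natr -[pi *+ 2]mulr_natl; ring.
case: k => n; first by rewrite -[RHS](H t n).
by rewrite NegzE intrN -[LHS](H _ n.+1); congr (f (_ * _)); rewrite subrK.
Qed.

Lemma sin_fracpart t : sin (2 * pi * fracpart t) = sin (2 * pi * t) :> R.
Proof. by have [k ->] := fracpart_shift t; apply: periodic_intr; exact: sinD2pi. Qed.

Lemma cos_fracpart t : cos (2 * pi * fracpart t) = cos (2 * pi * t) :> R.
Proof. by have [k ->] := fracpart_shift t; apply: periodic_intr; exact: cosD2pi. Qed.

Lemma continuous_snd_comp (f : R -> R) : continuous f ->
  continuous (fun p => f (2 * pi * p.2)).
Proof.
move=> cf p; apply: (@continuous_comp _ _ _ (fun p => 2 * pi * p.2) f); last exact: cf.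
apply: (@continuous_comp _ _ _ snd (fun t => 2 * pi * t)); first exact: cvg_snd.
exact: mulrl_continuous.
Qed.

Lemma continuous_height : continuous (fun p => height (tproj p)).
Proof.
have -> : (fun p => height (tproj p)) = (fun p => sin (2 * pi * p.2)).
  by apply/funext => p; rewrite /height /= sin_fracpart.
by apply: continuous_snd_comp; exact: continuous_sin.
Qed.

Lemma continuous_coheight :
  continuous (fun p => cos (2 * pi * (tcoord (tproj p)).2)).
Proof.
have -> : (fun p => cos (2 * pi * (tcoord (tproj p)).2)) = (fun p => cos (2 * pi * p.2)).
  by apply/funext => p; rewrite /= cos_fracpart.
by apply: continuous_snd_comp; exact: continuous_cos.
Qed.

(** The partial derivatives of the composite of [height] with [Psi]. *)
Definition dheight Psi (j : 'I_2) p : R :=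
  2 * pi * cos (2 * pi * (tcoord (Psi (tproj p))).2) * partial Psi 1 j (tproj p).

Lemma continuous_dheight Psi j : C1_map Psi -> continuous (dheight Psi j).
Proof.
move=> cPsi p; apply: cvgM; last exact: cPsi.2.
apply: cvgM; first exact: cvg_cst.
exact: (continuous_comp_torus (f := fun x => cos (2 * pi * (tcoord x).2)) cPsi
  continuous_coheight).
Qed.

Lemma height_lift Psi p q :
  height (Psi (tproj q)) = sin (2 * pi * (plane_lift Psi p q).2).
Proof. by rewrite /height -(tproj_lift Psi p) /= sin_fracpart. Qed.

Lemma is_derive_height1 Psi p : C1_map Psi ->
  is_derive p.1 1 (fun t => height (Psi (tproj (t, p.2)))) (dheight Psi 0 p).
Proof.
move=> cPsi; have [_ E2] := expands_lift p cPsi.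
have E := expands_slice1 E2.
have -> : (fun t => height (Psi (tproj (t, p.2)))) =
    sin \o (fun t => 2 * pi * (plane_lift Psi p (t, p.2)).2).
  by apply/funext => t; rewrite (height_lift _ p).
have D : is_derive p.1 1 (fun t => 2 * pi * (plane_lift Psi p (t, p.2)).2)
   (2 * pi * partial Psi 1 0 (tproj p)) := is_deriveZ (2 * pi) E.
have := is_derive1_comp (is_derive_sin _) D.
rewrite -surjective_pairing lift_base.
by congr (is_derive _ _ _ _); rewrite /dheight; ring.
Qed.

Lemma is_derive_height2 Psi p : C1_map Psi ->
  is_derive p.2 1 (fun t => height (Psi (tproj (p.1, t)))) (dheight Psi 1 p).
Proof.
move=> cPsi; have [_ E2] := expands_lift p cPsi.
have E := expands_slice2 E2.
have -> : (fun t => height (Psi (tproj (p.1, t)))) =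
    sin \o (fun t => 2 * pi * (plane_lift Psi p (p.1, t)).2).
  by apply/funext => t; rewrite (height_lift _ p).
have D : is_derive p.2 1 (fun t => 2 * pi * (plane_lift Psi p (p.1, t)).2)
   (2 * pi * partial Psi 1 1 (tproj p)) := is_deriveZ (2 * pi) E.
have := is_derive1_comp (is_derive_sin _) D.
rewrite -surjective_pairing lift_base.
by congr (is_derive _ _ _ _); rewrite /dheight; ring.
Qed.

Lemma dheight_le Psi j p : `|dheight Psi j p| <= 2 * pi * `|partial Psi 1 j (tproj p)|.
Proof.
rewrite /dheight !normrM (ger0_norm (pi_ge0 R)) [`|2|]ger0_norm //.
rewrite -mulrA ler_wpM2l ?mulr_ge0 ?pi_ge0 //.
by rewrite -[leRHS]mul1r ler_wpM2r // cos_max.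
Qed.

Lemma height_ge0 x : (tcoord x).2 < 2^-1 -> 0 <= height x.
Proof.
have [_ /andP[h0 _]] := tcoord_itv x; move=> h.
apply: sin_ge0_pi; have p0 := pi_gt0 R; apply/andP; split.
  by rewrite mulr_ge0 // mulr_ge0 // ltW.
have : (tcoord x).2 * pi <= 2^-1 * pi by rewrite ler_wpM2r ?(ltW p0) // ltW.
lra.
Qed.

Lemma height_le0 x : 2^-1 <= (tcoord x).2 -> height x <= 0.
Proof.
have [_ /andP[_ h1]] := tcoord_itv x; move=> h.
have -> : height x = - sin (2 * pi * (tcoord x).2 - pi).
  by rewrite -sinDpi subrK.
rewrite oppr_le0; apply: sin_ge0_pi; have p0 := pi_gt0 R.
have : 2^-1 * pi <= (tcoord x).2 * pi by rewrite ler_wpM2r ?(ltW p0).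
have : (tcoord x).2 * pi <= 1 * pi by rewrite ler_wpM2r ?(ltW p0) // ltW.
by move=> ? ?; apply/andP; split; lra.
Qed.

(** On the square of side [1/8] with lower left corner [(0, 1/8)], [height] is at
    least [sin (pi / 4)]. *)
Definition height_mass : R := sin (pi / 4) / 64.

Lemma height_mass_gt0 : 0 < height_mass.
Proof.
rewrite divr_gt0 //; apply: sin_gt0_pi; have p0 := pi_gt0 R.
by apply/andP; split; lra.
Qed.

Lemma height_mass_le :
  (height_mass%:E <=
   \int[lebesgue2 R]_(p in @unit_square R) `|height (tproj p)|%:E)%E.
Proof.
pose Q := cell (0, 8^-1) (8^-1 : R).
have mc : measurable Q by exact: measurable_cell.
have mU := @measurable_unit_square R.
have mh : measurable_fun setT (fun p => `|height (tproj p)|%:E).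
  apply/measurable_EFinP; apply: measurableT_comp => //.
  by apply: continuous_measurable_prod; exact: continuous_height.
have sub : Q `<=` @unit_square R.
  by move=> p /cellE /= [h1 h2]; rewrite /unit_square /= /in_unit_square; lra.
apply: (@le_trans _ _ (\int[lebesgue2 R]_(p in Q) `|height (tproj p)|%:E)%E); last first.
  by apply: ge0_subset_integral => //; exact: measurable_funTS.
apply: (@le_trans _ _ (\int[lebesgue2 R]_(p in Q) (sin (pi / 4))%:E)%E).
  rewrite integral_cst // [X in (_ * X)%E]measure_cell // -EFinM lee_fin.
  by rewrite /height_mass le_eqVlt; apply/orP; left; apply/eqP; field.
have p0 := pi_gt0 R.
apply: ge0_le_integral => //.
- move=> p _; rewrite lee_fin; apply: sin_ge0_pi.
  by apply/andP; split; lra.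
- exact: measurable_funTS.
move=> p cp; rewrite lee_fin; apply: le_trans (ler_norm _).
rewrite /height tprojK; last exact: sub.
move: cp => /cellE /= [_ /andP[h1 h2]].
have : 8^-1 * pi <= p.2 * pi by rewrite ler_wpM2r ?(ltW p0).
have : p.2 * pi <= 4^-1 * pi by rewrite ler_wpM2r ?(ltW p0) //; lra.
move=> h3 h4; rewrite leNgt ltr_sin ?in_itv /=; first by apply/negP; lra.
  by apply/andP; split; lra.
by apply/andP; split; lra.
Qed.

End height.

Section assembly.
Variable R : realType.
Implicit Types (Phi Psi : torus R -> torus R) (p q : R * R) (x y : torus R).

Lemma continuous_norm_comp (f : R * R -> R) :
  continuous f -> continuous (fun p => `|f p|).
Proof. by move=> cf p; apply: cvg_norm; exact: cf. Qed.

Lemma ge0_integralZ_continuous (D : set (R * R)) (k : R) (f : R * R -> R) :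
  measurable D -> 0 <= k -> (forall p, 0 <= f p) -> continuous f ->
  (\int[lebesgue2 R]_(p in D) (k * f p)%:E =
   k%:E * \int[lebesgue2 R]_(p in D) (f p)%:E)%E.
Proof.
move=> mD k0 f0 cf; under eq_integral do rewrite EFinM.
rewrite ge0_integralZl_EFin //.
- by move=> p _; rewrite lee_fin.
- by apply: measurable_funTS; exact: measurable_EFin_continuous.
Qed.

Lemma exists_dyadic_scale (eps : R) : 0 < eps <= 2^-1 ->
  exists n, 2 * eps <= 1 / 2 ^+ n <= 4 * eps.
Proof.
move=> /andP[e0 e1].
have ex : exists n, 1 / 2 ^+ n < 2 * eps.
  exists (Num.truncn (1 / (2 * eps))).+1.
  have e20 : 0 < 2 * eps by rewrite mulr_gt0.
  rewrite ltr_pdivrMr ?exprn_gt0 // mulrC -ltr_pdivrMr //.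
  apply: (lt_trans (truncnS_gt _)).
  by rewrite -natrX ltr_nat ltn_expl.
case: (ex_minnP ex) => -[|n] hn hmin; first by move: hn; rewrite expr0 divr1; lra.
exists n; apply/andP; split.
  by rewrite leNgt; apply/negP => /hmin; rewrite ltnn.
have : 1 / 2 ^+ n = 2 * (1 / 2 ^+ n.+1) :> R by rewrite exprS; field; rewrite expf_neq0.
lra.
Qed.

(** The unit square is cut into dyadic squares of side between [2 eps] and
    [4 eps]; each contains a ball of radius [eps], and [poincare_cell] applies
    to it with the sets of [mixing_cell]. *)
Lemma poincare_mixing Phi Psi (kappa eps : R) :
  cancel Phi Psi -> cancel Psi Phi -> C1_map Psi -> 0 < kappa < 1 ->
  0 < eps <= 2^-1 -> mixes kappa eps Phi (@half_torus R) ->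
  (\int[lebesgue2 R]_(p in @unit_square R)
     (kappa / 64 * `|height (Psi (tproj p))|)%:E
   <= \int[lebesgue2 R]_(p in @unit_square R)
     (4 * eps * (`|dheight Psi 0 p| + `|dheight Psi 1 p|))%:E)%E.
Proof.
move=> PhiK PsiK cPsi kap eps01 mix; have /andP[eps0 _] := eps01.
have [n /andP[n1 n2]] := exists_dyadic_scale eps01.
have k640 : 0 < kappa / 64 by rewrite divr_gt0 //; case/andP: kap.
pose g p := height (Psi (tproj p)).
have cg : continuous g by exact: (continuous_comp_torus cPsi (@continuous_height R)).
have cD j : continuous (dheight Psi j) by exact: continuous_dheight.
pose f1 p := kappa / 64 * `|g p|.
pose f2 p := 4 * eps * (`|dheight Psi 0 p| + `|dheight Psi 1 p|).
have f10 p : (0 <= (f1 p)%:E)%E by rewrite lee_fin mulr_ge0 // ltW.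
have f20 p : (0 <= (f2 p)%:E)%E.
  by rewrite lee_fin mulr_ge0 ?addr_ge0 // mulr_ge0 // ltW.
have cf1 : continuous f1.
  by move=> p; apply: cvgM; [exact: cvg_cst|exact: continuous_norm_comp].
have cf2 : continuous f2.
  move=> p; apply: cvgM; first exact: cvg_cst.
  by apply: cvgD; exact: continuous_norm_comp.
have mf1 := measurable_EFin_continuous cf1.
have mf2 := measurable_EFin_continuous cf2.
pose good a s := (\int[lebesgue2 R]_(p in setT `&` id @^-1` cell a s) (f1 p)%:E
  <= \int[lebesgue2 R]_(p in setT `&` id @^-1` cell a s) (f2 p)%:E)%E.
suff : good (0, 0) 1 by rewrite /good setTI preimage_id -unit_squareE.
apply: (@cell_subdivision R good _ n (0, 0) 1 ltr01).
  move=> a s s0 h00 h10 h01 h11; rewrite /good.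
  rewrite (integral_preimage_cell_split (T := id) a measurableT _ mf1 f10 s0) //.
  rewrite (integral_preimage_cell_split (T := id) a measurableT _ mf2 f20 s0) //.
  exact: leeD (leeD h00 h10) (leeD h01 h11).
move=> b /= b1 b1' b2 b2'; rewrite !add0r in b1' b2'.
set t := 1 / 2 ^+ n in n1 n2 b1' b2' *.
have t0 : 0 < t by rewrite divr_gt0 // exprn_gt0.
rewrite /good setTI preimage_id.
have mc := @measurable_cell R b t.
have HN := mixing_cell PhiK PsiK cPsi kap eps0 mix n1 n2 b1 b1' b2 b2'.
have HN' (sg : bool) : exists N : set (R * R), [/\ measurable N, N `<=` cell b t,
     ((kappa / 64 * t ^+ 2)%:E <= lebesgue2 R N)%E &
     forall z, N z -> 0 <= (-1) ^+ sg * g z].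
  have [N [mN Nc lN hN]] := HN sg; exists N; split => // z /hN.
  case: sg {lN hN} => h; rewrite /g.
    by rewrite expr1 mulN1r oppr_ge0; exact: height_le0.
  by rewrite expr0 mul1r; exact: height_ge0.
have P := poincare_cell t0 k640 cg (cD 0) (cD 1)
  (fun p => is_derive_height1 p cPsi) (fun p => is_derive_height2 p cPsi) HN'.
rewrite ge0_integralZ_continuous //; last exact: continuous_norm_comp.
- apply: le_trans P _.
  rewrite ge0_integralZ_continuous //.
  + under [X in (_ <= _ * X)%E]eq_integral do rewrite EFinD.
    rewrite ge0_integralD //.
    * apply: lee_wpmul2r; last by rewrite lee_fin.
      by apply: adde_ge0; apply: integral_ge0 => p _; rewrite lee_fin.
    * by apply: measurable_funTS; apply: measurable_EFin_continuous; exact: continuous_norm_comp.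
    * by apply: measurable_funTS; apply: measurable_EFin_continuous; exact: continuous_norm_comp.
  + by rewrite mulr_ge0 // ltW.
  + by move=> p; apply: cvgD; exact: continuous_norm_comp.
- exact: ltW.
Qed.

End assembly.

(** * Energy estimates *)

Section energy.
Variable R : realType.
Implicit Types (Phi Psi : torus R -> torus R) (p q : R * R) (x y : torus R).

(** The second row of the inverse matrix is [(- d_1 Phi^2, d_1 Phi^1) / det]. *)
Lemma adjugate_row Phi Psi x : cancel Phi Psi -> C1_map Phi -> C1_map Psi ->
  (`|partial Psi 1 0 (Phi x)| + `|partial Psi 1 1 (Phi x)|) * `|jac Phi x| =
  `|partial Phi 1 0 x| + `|partial Phi 0 0 x|.
Proof.
move=> PhiK cPhi cPsi; have [_ _ h1 h2] := inverse_jacobian x PhiK cPhi cPsi.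
rewrite /jac; move: h1 h2.
move: (partial Psi 1 0 _) (partial Psi 1 1 _) => c' d'.
move: (partial Phi 0 0 _) (partial Phi 0 1 _) => a b.
move: (partial Phi 1 0 _) (partial Phi 1 1 _) => c d h1 h2; rewrite mulrDl -!normrM.
have -> : c' * (a * d - b * c) = d * (c' * a + d' * c) - c * (c' * b + d' * d) by ring.
have -> : d' * (a * d - b * c) = a * (c' * b + d' * d) - b * (c' * a + d' * c) by ring.
by rewrite h1 h2 !mulr0 !mulr1 sub0r subr0 normrN.
Qed.

Lemma jac_inverse_le Phi Psi (k : R) y : cancel Phi Psi -> cancel Psi Phi ->
  C1_map Phi -> C1_map Psi -> 0 < k -> (forall x, k <= `|jac Phi x|) ->
  `|jac Psi y| <= k^-1.
Proof.
move=> PhiK PsiK cPhi cPsi k0 hk.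
have := jac_inverse (Psi y) PhiK cPhi cPsi; rewrite PsiK => /(congr1 Num.norm).
rewrite normrM normr1 => h.
have j0 : 0 < `|jac Phi (Psi y)| by exact: lt_le_trans k0 (hk _).
have -> : `|jac Psi y| = `|jac Phi (Psi y)|^-1.
  by apply: (mulIf (lt0r_neq0 j0)); rewrite h mulVf // lt0r_neq0.
by rewrite lef_pV2.
Qed.

Lemma energy_density_ge0 Phi x : 0 <= energy_density Phi x.
Proof. by rewrite /energy_density mulr_ge0 // !addr_ge0 // sqr_ge0. Qed.

Lemma measurable_energy_density Phi : C1_map Phi ->
  measurable_fun setT (fun p => (energy_density Phi (tproj p))%:E).
Proof.
move=> [_ cPhi]; apply/measurable_EFinP.
have m i j : measurable_fun setT (fun p => partial Phi i j (tproj p) ^+ 2).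
  by apply: measurable_funX; exact: continuous_measurable_prod.
apply: measurable_funM => //.
by apply: measurable_funD => //; apply: measurable_funD => //; apply: measurable_funD.
Qed.

Lemma jac_le_energy_density Phi x : `|jac Phi x| <= energy_density Phi x.
Proof.
rewrite /jac /energy_density ler_norml.
move: (partial Phi 0 0 x) (partial Phi 0 1 x) => a b.
move: (partial Phi 1 0 x) (partial Phi 1 1 x) => c d.
have h1 := sqr_ge0 (a + d); have h2 := sqr_ge0 (a - d).
have h3 := sqr_ge0 (b + c); have h4 := sqr_ge0 (b - c).
by apply/andP; split; nra.
Qed.

Lemma energy_ge_jac Phi (k : R) : C1_map Phi -> 0 <= k ->
  (forall x, k <= `|jac Phi x|) -> (k%:E <= energy Phi)%E.
Proof.
move=> cPhi k0 hk.
have -> : k%:E = (\int[lebesgue2 R]_(p in @unit_square R) k%:E)%E.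
  rewrite integral_cst; last exact: measurable_unit_square.
  by rewrite [X in (_ * X)%E]measure_unit_square mule1.
apply: ge0_le_integral => //.
- exact: measurable_unit_square.
- by apply: measurable_funTS; exact: measurable_energy_density.
- by move=> p _; rewrite lee_fin; apply: le_trans (hk _) (jac_le_energy_density _ _).
Qed.

(** The weighted inequality [|v| <= (lam v^2 + 1 / lam) / 2] replaces the
    Cauchy-Schwarz inequality. *)
Lemma row_le_energy_density Phi x (lam : R) : 0 < lam ->
  `|partial Phi 1 0 x| + `|partial Phi 0 0 x| <= lam * energy_density Phi x + lam^-1.
Proof.
move=> l0; rewrite /energy_density.
move: (partial Phi 0 0 x) (partial Phi 0 1 x) => a b.
move: (partial Phi 1 0 x) (partial Phi 1 1 x) => c d.
have H (v : R) : `|v| <= (lam * v ^+ 2 + lam^-1) / 2.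
  have h : 0 <= lam * (`|v| - lam^-1) ^+ 2 by rewrite mulr_ge0 ?sqr_ge0 // ltW.
  have e : lam * (`|v| - lam^-1) ^+ 2 = lam * v ^+ 2 + lam^-1 - 2 * `|v|.
    rewrite sqrrB real_normK ?num_real //; field; exact: lt0r_neq0.
  lra.
have hb : 0 <= lam * b ^+ 2 by rewrite mulr_ge0 ?sqr_ge0 // ltW.
have hd : 0 <= lam * d ^+ 2 by rewrite mulr_ge0 ?sqr_ge0 // ltW.
have := H a; have := H c; lra.
Qed.

Lemma integral_row_le Phi (lam : R) : C1_map Phi -> 0 < lam ->
  (\int[lebesgue2 R]_(p in @unit_square R)
      (`|partial Phi 1 0 (tproj p)| + `|partial Phi 0 0 (tproj p)|)%:E
   <= lam%:E * energy Phi + (lam^-1)%:E)%E.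
Proof.
move=> cPhi l0; have mU := @measurable_unit_square R.
have ca i j : continuous (fun p => `|partial Phi i j (tproj p)|).
  exact: continuous_norm_comp (cPhi.2 i j).
have me := measurable_energy_density cPhi.
have e0 p : (0 <= (energy_density Phi (tproj p))%:E)%E.
  by rewrite lee_fin energy_density_ge0.
apply: (@le_trans _ _ (\int[lebesgue2 R]_(p in @unit_square R)
   (lam%:E * (energy_density Phi (tproj p))%:E + (lam^-1)%:E))%E).
  apply: ge0_le_integral => //.
  - apply: measurable_funTS; apply: measurable_EFin_continuous => p.
    by apply: cvgD; exact: ca.
  - apply: measurable_funTS; apply: emeasurable_funD => //.
    exact: measurable_funeM.
  - by move=> p _; rewrite -EFinM -EFinD lee_fin; exact: row_le_energy_density.
have l0E : (0 <= lam%:E)%E by rewrite lee_fin ltW.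
rewrite ge0_integralD //.
- rewrite ge0_integralZl //; last exact: measurable_funTS.
  by rewrite integral_cst // [X in (_ + _ * X)%E]measure_unit_square mule1.
- by move=> p _; rewrite mule_ge0.
- by apply: measurable_funTS; exact: measurable_funeM.
- by move=> p _; rewrite lee_fin invr_ge0 ltW.
Qed.

(** The choice [lam = 2 M eps / c] makes the term [M eps / lam] equal to [c / 2]. *)
Lemma optimize_scale (M c r eps : R) : 0 < M -> 0 < c -> 0 < eps ->
  (forall lam, 0 < lam -> c <= M * eps * (lam * r + lam^-1)) ->
  c ^+ 2 / (4 * M ^+ 2) / eps ^+ 2 <= r.
Proof.
move=> M0 c0 e0 H.
have Me : 0 < M * eps by rewrite mulr_gt0.
have l0 : 0 < 2 * (M * eps) / c by rewrite divr_gt0 // mulr_gt0.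
have := H _ l0.
have -> : M * eps * (2 * (M * eps) / c * r + (2 * (M * eps) / c)^-1) =
   2 * (M * eps) ^+ 2 / c * r + c / 2.
  by field; rewrite !gt_eqF.
move=> h.
have h2 : c / 2 <= 2 * (M * eps) ^+ 2 / c * r by lra.
have -> : c ^+ 2 / (4 * M ^+ 2) / eps ^+ 2 = c / 2 * (c / (2 * (M * eps) ^+ 2)).
  by field; rewrite !gt_eqF.
have -> : r = 2 * (M * eps) ^+ 2 / c * r * (c / (2 * (M * eps) ^+ 2)).
  by field; rewrite !gt_eqF.
by rewrite ler_wpM2r // divr_ge0 ?mulr_ge0 ?sqr_ge0 // ltW.
Qed.

End energy.

Section main.
Variable R : realType.
Implicit Types (Phi Psi : torus R -> torus R) (p q : R * R) (x y : torus R).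

Lemma det_jacobian Phi x : \det (jacobian_mx Phi x) = jac Phi x.
Proof.
rewrite (expand_det_row _ 0) big_ord_recl big_ord1 /cofactor !det_mx11 !mxE /=.
have -> : lift 0 0 = 1 :> 'I_2 by exact: val_inj.
have -> : lift 1 0 = 0 :> 'I_2 by exact: val_inj.
rewrite /jac; move: (partial Phi 0 0 x) (partial Phi 0 1 x) => a b.
move: (partial Phi 1 0 x) (partial Phi 1 1 x) => c d.
by rewrite expr0 expr1 mul1r mulN1r mulrN.
Qed.

Lemma ge0_le_fin (x : \bar R) (r : R) : (0 <= x)%E -> (x <= r%:E)%E ->
  exists2 r' : R, x = r'%:E & r' <= r.
Proof. by case: x => [r'| |] // _; rewrite lee_fin; exists r'. Qed.

(** The two factors [72] come from the two changes of variables, [64 / kappa] from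
    the proportion of area in [mixing_cell], and [8 pi] from the derivative of
    [height] and the side, at most [4 eps], of the squares. *)
Definition mixing_factor (kappa : R) : R := 72 * (64 * (8 * pi * (72 / kappa))).

Lemma mixing_factor_gt0 (kappa : R) : 0 < kappa -> 0 < mixing_factor kappa.
Proof. by move=> k0; rewrite !mulr_gt0 ?pi_gt0 ?invr_gt0. Qed.

(** With [X], [Z] and [W] the integrals of [|height o Psi|], of the second row of
    the Jacobian matrix of [Psi] and of the first column of that of [Phi]:
    [X] is bounded below and [Z] above by change of variables, and the Poincare
    inequality bounds [X] by [Z]. *)
Lemma energy_tradeoff Phi Psi (kappa k eps lam r : R) :
  cancel Phi Psi -> cancel Psi Phi -> C1_map Phi -> C1_map Psi ->
  0 < kappa < 1 -> 0 < eps <= 2^-1 -> mixes kappa eps Phi (@half_torus R) ->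
  0 < k -> (forall x, k <= `|jac Phi x|) -> energy Phi = r%:E -> 0 < lam ->
  height_mass R * k <= mixing_factor kappa * eps * (lam * r + lam^-1).
Proof.
move=> PhiK PsiK cPhi cPsi kap eps01 mix k0 hk Er l0.
have kappa0 : 0 < kappa by case/andP: kap.
have eps0 : 0 < eps by case/andP: eps01.
have kap64 : 0 < kappa / 64 by rewrite divr_gt0.
have mU := @measurable_unit_square R.
have cd j : continuous (fun p => `|partial Psi 1 j (tproj p)|).
  exact: continuous_norm_comp (cPsi.2 1 j).
have ca i j : continuous (fun p => `|partial Phi i j (tproj p)|).
  exact: continuous_norm_comp (cPhi.2 i j).
have ch := @continuous_height R.
have cg : continuous (fun p => height (Psi (tproj p))).
  exact: (continuous_comp_torus cPsi ch).
pose X := (\int[lebesgue2 R]_(p in @unit_square R) `|height (Psi (tproj p))|%:E)%E.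
pose fz y := `|partial Psi 1 0 y| + `|partial Psi 1 1 y|.
pose fw x := `|partial Phi 1 0 x| + `|partial Phi 0 0 x|.
have cz : continuous (fun p => fz (tproj p)).
  by move=> p; apply: cvgD; exact: cd.
have cw : continuous (fun p => fw (tproj p)).
  by move=> p; apply: cvgD; exact: ca.
pose Z := (\int[lebesgue2 R]_(p in @unit_square R) (fz (tproj p))%:E)%E.
pose W := (\int[lebesgue2 R]_(p in @unit_square R) (fw (tproj p))%:E)%E.
have X0 : (0 <= X)%E by apply: integral_ge0 => p _; rewrite lee_fin.
have Z0 : (0 <= Z)%E by apply: integral_ge0 => p _; rewrite lee_fin addr_ge0.
have W0 : (0 <= W)%E by apply: integral_ge0 => p _; rewrite lee_fin addr_ge0.
have hX : ((height_mass R)%:E <= 72%:E * ((k^-1)%:E * X))%E.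
  apply: le_trans (@height_mass_le R) _.
  rewrite -ge0_integralZ_continuous ?invr_ge0 ?(ltW k0) //; last first.
    exact: continuous_norm_comp.
  apply: (@integral_image_le R Psi Phi (fun x => `|height x|)
    (fun y => k^-1 * `|height (Psi y)|)) => //.
  - exact: continuous_norm_comp.
  - by move=> p; apply: cvgM; [exact: cvg_cst|exact: continuous_norm_comp].
  - move=> y; rewrite mulrC ler_wpM2r //.
    exact: jac_inverse_le PhiK PsiK cPhi cPsi k0 hk.
have hXZ : ((kappa / 64)%:E * X <= (8 * pi * eps)%:E * Z)%E.
  have p0 : 0 <= 8 * pi * eps by rewrite mulr_ge0 ?(ltW eps0) // mulr_ge0 // pi_ge0.
  have fz0 p : 0 <= fz (tproj p) by rewrite addr_ge0.
  rewrite /X /Z -(ge0_integralZ_continuous mU p0 fz0 cz).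
  rewrite -(ge0_integralZ_continuous mU (ltW kap64) (fun p => normr_ge0 _)
    (continuous_norm_comp cg)).
  apply: le_trans (poincare_mixing PhiK PsiK cPsi kap eps01 mix) _.
  apply: ge0_le_integral => //.
  - by move=> p _; rewrite lee_fin mulr_ge0 ?addr_ge0 // mulr_ge0 // ltW.
  - apply: measurable_funTS; apply: measurable_EFin_continuous => p.
    apply: cvgM; first exact: cvg_cst.
    by apply: cvgD; apply: continuous_norm_comp; exact: continuous_dheight.
  - apply: measurable_funTS; apply: measurable_EFin_continuous => p.
    by apply: cvgM; [exact: cvg_cst|exact: cz].
  - move=> p _; rewrite lee_fin.
    have -> : 8 * pi * eps * fz (tproj p) = 4 * eps * (2 * pi * fz (tproj p)) by ring.
    rewrite ler_wpM2l ?mulr_ge0 ?(ltW eps0) // /fz mulrDr.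
    by apply: lerD; exact: dheight_le.
have hZW : (Z <= 72%:E * W)%E.
  apply: (@integral_image_le R Phi Psi fz fw) => //.
    by move=> y; rewrite addr_ge0.
  by move=> x; rewrite /fz /fw (adjugate_row x PhiK cPhi cPsi).
have hW : (W <= (lam * r + lam^-1)%:E)%E.
  by have := integral_row_le cPhi l0; rewrite Er -EFinM -EFinD.
have [w wE wle] := ge0_le_fin W0 hW.
have hZW' : (Z <= (72 * w)%:E)%E by rewrite EFinM -wE.
have [z zE zle] := ge0_le_fin Z0 hZW'.
move: hX hXZ X0; rewrite zE -EFinM; case: X => [x'| |//].
  rewrite -!EFinM !lee_fin => h1 h2 _.
  have h3 : x' <= (kappa / 64)^-1 * (8 * pi * eps * z) by rewrite ler_pdivlMl.
  have h4 : z <= 72 * (lam * r + lam^-1) by apply: le_trans zle _; rewrite ler_wpM2l.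
  apply: (@le_trans _ _ (72 * (k^-1 * x') * k)); first by rewrite ler_wpM2r // ltW.
  have -> : 72 * (k^-1 * x') * k = 72 * x' by field; exact: lt0r_neq0.
  have -> : mixing_factor kappa * eps * (lam * r + lam^-1) =
    72 * ((kappa / 64)^-1 * (8 * pi * eps * (72 * (lam * r + lam^-1)))).
    by rewrite /mixing_factor; field; rewrite !lt0r_neq0.
  rewrite ler_wpM2l //; apply: le_trans h3 _.
  rewrite ler_wpM2l ?invr_ge0 ?(ltW kap64) // ler_wpM2l //.
  by rewrite mulr_ge0 ?(ltW eps0) // mulr_ge0 // pi_ge0.
by move=> _; rewrite gt0_muley ?lte_fin // leye_eq.
Qed.

End main.

Theorem mainTheorem1 (R : realType) (kappa kappa' : R)
    (hkappa : 0 < kappa < 2^-1) (hkappa' : 0 < kappa') :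
  exists C : R, 0 < C /\
    forall (eps : R), 0 < eps ->
    forall (Phi : torus R -> torus R),
      diffeomorphism Phi ->
      mixes kappa eps Phi (@half_torus R) ->
      (forall x : torus R, kappa' <= `|\det (jacobian_mx Phi x)|) ->
      ((C / eps ^+ 2)%:E <= energy Phi)%E.
Proof.
have kappa0 : 0 < kappa by case/andP: hkappa.
have kappa1 : 0 < kappa < 1 by lra.
have M0 := mixing_factor_gt0 kappa0; set M := mixing_factor kappa in M0.
have c0 : 0 < height_mass R * kappa' by rewrite mulr_gt0 // height_mass_gt0.
set c := height_mass R * kappa' in c0.
pose C1 := c ^+ 2 / (4 * M ^+ 2).
have C10 : 0 < C1.
  apply: divr_gt0; first exact: exprn_gt0.
  by apply: mulr_gt0 => //; exact: exprn_gt0.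
exists (Num.min (kappa' / 4) C1); split; first by rewrite lt_min C10 divr_gt0.
move=> eps e0 Phi [Psi [PhiK PsiK cPhi cPsi]] mix hdet.
have hk x : kappa' <= `|jac Phi x| by rewrite -det_jacobian.
have e20 : 0 < eps ^+ 2 by rewrite exprn_gt0.
have [e1|e1] := leP eps 2^-1; last first.
  apply: le_trans (energy_ge_jac cPhi (ltW hkappa') hk).
  rewrite lee_fin ler_pdivrMr //.
  have h : Num.min (kappa' / 4) C1 <= kappa' / 4 by rewrite ge_min lexx.
  apply: le_trans h _; rewrite ler_wpM2l ?(ltW hkappa') //.
  have -> : 4^-1 = 2^-1 ^+ 2 :> R by field.
  by rewrite ler_sqr ?nnegrE ?ltW.
case Er : (energy Phi) => [r| |]; last 2 first.
- by rewrite leey.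
- have : (0 <= energy Phi)%E.
    by apply: integral_ge0 => p _; rewrite lee_fin energy_density_ge0.
  by rewrite Er.
rewrite lee_fin.
apply: (@le_trans _ _ (C1 / eps ^+ 2)).
  by rewrite ler_wpM2r ?invr_ge0 ?(ltW e20) // ge_min lexx orbT.
apply: optimize_scale => // lam l0.
apply: energy_tradeoff PhiK PsiK cPhi cPsi kappa1 _ mix hkappa' hk Er l0.
by rewrite e0 e1.
Qed.
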